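(* Let $K$ be a field and let $H$ be a Hopf algebra over $K$ with an $ad$-coinvariant integral and such that $H$ is formally smooth as a coalgebra in $\mathfrak{M}_{K}$. Let $\mathcal{M}$ be either $\mathfrak{M}_{H}$ or ${}_{H}\mathfrak{M}_{H}$. If $H$ is a subcoalgebra of a coalgebra $E$ in $\mathcal{M}$ and $\mathrm{Corad}(E)\subseteq H$, then there exists a coalgebra homomorphism $\pi:E\to H$ in $\mathcal{M}$ such that $\pi_{\mid H}=\mathrm{Id}_{H}$.
   Context: Notation: $\Delta(h)=h_1\otimes h_2$ (Sweedler), $\varepsilon$ the counit, $S$ the antipode of $H$. $ad$-coinvariant integral: an element $t\in H$ such that (a) $ht=\varepsilon(h)t$ for all $h\in H$; (b) $t_1S(t_3)\otimes t_2=1_H\otimes t$; (c) $\varepsilon(t)=1_K$. $\mathfrak{M}_K$ is the category of $K$-vector spaces. $\mathfrak{M}_H$ (resp. ${}_H\mathfrak{M}_H$) is the monoidal category of right $H$-modules (resp. $H$-bimodules), with $\otimes_K$ carrying diagonal action(s) and unit $K$ (action via $\varepsilon$). $H$ is a coalgebra in both via its multiplication; ''$H$ is a subcoalgebra of $E$ in $\mathcal{M}$'' means that $H\subseteq E$ is simultaneously a subcoalgebra and a subobject in $\mathcal{M}$. A coalgebra homomorphism in $\mathcal{M}$ is a coalgebra homomorphism that is a morphism of $\mathcal{M}$. $\mathrm{Corad}(E)$ is the coradical of $E$ (the sum of its simple $K$-subcoalgebras). A $K$-coalgebra $(C,\Delta,\varepsilon)$ is formally smooth as a coalgebra in $\mathfrak{M}_K$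 if the $C$-bicomodule $\mho_1C=\mathrm{Coker}\,\Delta$ is injective relative to those $C$-bicomodule morphisms that have a $K$-linear retraction (since $K$ is a field, equivalently it is an injective $C$-bicomodule). *)

(* Defs.v *)
From HB Require Import structures.
From mathcomp Require Import all_boot all_algebra.
From mathcomp Require Import finmap boolp classical_sets.
From mathcomp.multinomials Require Import monalg.

Set Implicit Arguments.
Unset Strict Implicit.
Unset Printing Implicit Defensive.

Import GRing.Theory.

Local Open Scope classical_set_scope.
Local Open Scope ring_scope.
Local Open Scope quotient_scope.

Section LinearSpan.
Variables (K : fieldType) (V : lmodType K).

Definition lspan (S : set V) : {pred V} := fun x =>
  `[< forall P : {pred V},
        submod_closed P -> (forall y, S y -> y \in P) -> x \in P >].

Lemma lspanP (S : set V) x :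
  reflect (forall P : {pred V},
             submod_closed P -> (forall y, S y -> y \in P) -> x \in P)
          (x \in lspan S).
Proof. exact: asboolP. Qed.

Lemma lspan_submod (S : set V) : submod_closed (lspan S).
Proof.
split=> [|a x y xS yS]; apply/lspanP => P Psub SP; first by case: Psub.
by case: (Psub) => _; apply; [exact: (lspanP _ _ xS)|exact: (lspanP _ _ yS)].
Qed.

Lemma sub_lspan (S : set V) x : S x -> x \in lspan S.
Proof. by move=> Sx; apply/lspanP => P _; apply. Qed.

HB.instance Definition _ (S : set V) :=
  GRing.isSubmodClosed.Build K V (lspan S) (lspan_submod S).

Lemma lspan_ker (S : set V) (U : lmodType K) (f : {linear V -> U}) :
  (forall x, S x -> f x = 0) -> {in lspan S, forall x, f x = 0}.
Proof.
move=> fS x /lspanP /(_ [pred x | f x == 0])/= xS; apply/eqP/xS => [|y Sy].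
  split=> [|a y z]; rewrite !inE ?raddf0// linearP => /eqP-> /eqP->.
  by rewrite scaler0 addr0.
by rewrite inE fS.
Qed.
End LinearSpan.

(* The quotient of V by the subspace spanned by S. Its construction is opaque,
   so that unification never looks inside it: it is used through the fields. *)
Record linear_quotient (K : fieldType) (V : lmodType K) (S : set V) :=
  LinearQuotient {
    lq_space : lmodType K;
    lq_proj : {linear V -> lq_space};
    lq_repr : lq_space -> V;
    lq_reprK : cancel lq_repr lq_proj;
    lq_proj_eq0 : forall x, (lq_proj x == 0) = (x \in lspan S)
  }.

Section QuotientConstruction.
Variables (K : fieldType) (V : lmodType K) (S : set V).

Let quot : Type := Quotient.quot (lspan S).
HB.instance Definition _ := GRing.Zmodule.on quot.

Let proj (x : V) : quot := \pi_(Quotient.quot (lspan S)) x.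
Let rep (q : quot) : V := repr (q : Quotient.quot (lspan S)).

Let repK : cancel rep proj.
Proof. exact: reprK. Qed.

Let proj_eq x y : (proj x == proj y) = (x - y \in lspan S).
Proof. by rewrite Quotient.idealrBE. Qed.

Let proj_is_zmod_morphism : zmod_morphism proj.
Proof. exact: pi_is_zmod_morphism. Qed.
HB.instance Definition _ :=
  GRing.isZmodMorphism.Build V quot proj proj_is_zmod_morphism.

Let scale (a : K) (q : quot) : quot := proj (a *: rep q).

Let scaleE a x : scale a (proj x) = proj (a *: x).
Proof. by apply/eqP; rewrite proj_eq -scalerBr rpredZ// -proj_eq repK. Qed.

Let scaleA a b q : scale a (scale b q) = scale (a * b) q.
Proof. by rewrite -[q]repK !scaleE scalerA. Qed.
Let scale1 : left_id 1 scale.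
Proof. by move=> q; rewrite -[q]repK scaleE scale1r. Qed.
Let scaleDr : right_distributive scale +%R.
Proof.
by move=> a p q; rewrite -[p]repK -[q]repK -raddfD !scaleE scalerDr raddfD.
Qed.
Let scaleDl q : {morph scale^~ q : a b / a + b}.
Proof. by move=> a b; rewrite -[q]repK !scaleE scalerDl raddfD. Qed.

HB.instance Definition _ := GRing.Zmodule_isLmodule.Build K quot
  scaleA scale1 scaleDr scaleDl.

Let proj_is_scalable : scalable proj.
Proof. by move=> a x; rewrite -scaleE. Qed.
HB.instance Definition _ :=
  GRing.isScalable.Build K V quot *:%R proj proj_is_scalable.

Definition linear_quotient_construction : linear_quotient S.
Proof.
apply: (@LinearQuotient _ _ _ quot proj rep repK) => x.
by rewrite -(raddf0 proj) proj_eq subr0.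
Qed.
End QuotientConstruction.

Section Quotient.
Variables (K : fieldType) (V : lmodType K) (S : set V).

Definition lquot : lmodType K := lq_space (linear_quotient_construction S).
Definition lproj : {linear V -> lquot} := lq_proj (linear_quotient_construction S).
Definition lrepr : lquot -> V := @lq_repr _ _ _ (linear_quotient_construction S).

Lemma lreprK : cancel lrepr lproj.
Proof. exact: lq_reprK. Qed.

Lemma lproj_eq0 x : (lproj x == 0) = (x \in lspan S).
Proof. exact: lq_proj_eq0. Qed.

Lemma lproj_eq x y : (lproj x == lproj y) = (x - y \in lspan S).
Proof. by rewrite -lproj_eq0 raddfB subr_eq0. Qed.

(* Meaningful when f is linear and vanishes on S: see lquot_liftE. *)
Definition lquot_lift (U : lmodType K) (f : V -> U) (q : lquot) : U := f (lrepr q).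

Lemma lquot_liftE (U : lmodType K) (f : {linear V -> U}) x :
  (forall x, S x -> f x = 0) -> lquot_lift f (lproj x) = f x.
Proof.
move=> fS; apply/eqP; rewrite -subr_eq0 -raddfB; apply/eqP/(lspan_ker fS).
by rewrite -lproj_eq lreprK.
Qed.

Lemma lquot_lift_is_linear (U : lmodType K) (f : {linear V -> U}) :
  (forall x, S x -> f x = 0) -> linear (lquot_lift f).
Proof.
move=> fS a p q; rewrite -[p]lreprK -[q]lreprK -linearP !lquot_liftE//.
by rewrite linearP.
Qed.
End Quotient.

Section FreeModule.
Variables (K : fieldType) (I : choiceType) (U : lmodType K).
Implicit Types (f : I -> U) (g : {malg K[I]}).

Definition malg_lift f g : U := (\sum_(i <- msupp g) g@_i *: f i)%R.

Lemma malg_liftw f g (d : {fset I}) : (msupp g `<=` d)%fset ->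
  malg_lift f g = (\sum_(i <- d) g@_i *: f i)%R.
Proof.
move=> gd; rewrite /malg_lift (big_fset_incl _ gd)// => i _ /mcoeff_outdom ->.
by rewrite scale0r.
Qed.

Lemma malg_lift_is_linear f : linear (malg_lift f).
Proof.
move=> a g h; pose d := (msupp g `|` msupp h)%fset.
have sd : (msupp (a *: g + h) `<=` d)%fset.
  by apply: (fsubset_trans (msuppD_le _ _)); rewrite fsetSU// msuppZ_le.
rewrite (malg_liftw _ sd) !(@malg_liftw _ _ d) ?fsubsetUl ?fsubsetUr//.
rewrite scaler_sumr -big_split/=; apply: eq_bigr => i _.
by rewrite mcoeffD mcoeffZ scalerDl scalerA.
Qed.
HB.instance Definition _ f :=
  GRing.isLinear.Build K {malg K[I]} U *:%R (malg_lift f) (malg_lift_is_linear f).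

Lemma malg_liftU f a i : malg_lift f << a *g i >> = a *: f i.
Proof.
by rewrite (@malg_liftw _ _ [fset i]%fset) ?msuppU_le// big_seq_fset1 mcoeffUU.
Qed.
End FreeModule.

(* The tensor product over K, with its universal property. The field tp_lift is
   total for convenience; it is only meaningful on bilinear maps. As for
   quotients, the construction below is opaque. *)
Record tensor_product (K : fieldType) (V W : lmodType K) := TensorProduct {
  tp_space : lmodType K;
  tp_pure : V -> W -> tp_space;
  tp_pure_bilinear : bilinear_for *:%R *:%R tp_pure;
  tp_lift : forall U : lmodType K, (V -> W -> U) -> tp_space -> U;
  tp_lift_linear : forall (U : lmodType K) (f : V -> W -> U),
    bilinear_for *:%R *:%R f -> linear (tp_lift f);
  tp_liftE : forall (U : lmodType K) (f : V -> W -> U) v w,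
    bilinear_for *:%R *:%R f -> tp_lift f (tp_pure v w) = f v w;
  tp_ext : forall (U : lmodType K) (f g : {linear tp_space -> U}),
    (forall v w, f (tp_pure v w) = g (tp_pure v w)) -> f =1 g
}.

Section TensorConstruction.
Variables (K : fieldType) (V W : lmodType K).

Local Notation gen v w := (<< 1 *g (v, w) >> : {malg K[(V * W)%type]}).

Let tensor_rel : set {malg K[(V * W)%type]} :=
  [set r | exists a v v' w, r = gen (a *: v + v') w - (a *: gen v w + gen v' w)]
  `|` [set r | exists a v w w', r = gen v (a *: w + w') - (a *: gen v w + gen v w')].

Let pure (v : V) (w : W) : lquot tensor_rel := lproj tensor_rel (gen v w).

Let pure_bilinear : bilinear_for *:%R *:%R pure.
Proof.
split=> [w a v v'|v a w w']; rewrite /= /applyr /pure -linearP; apply/eqP;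
  rewrite lproj_eq sub_lspan//.
  by left; exists a, v, v', w.
by right; exists a, v, w, w'.
Qed.

Let lift (U : lmodType K) (f : V -> W -> U) : lquot tensor_rel -> U :=
  lquot_lift (malg_lift (fun p => f p.1 p.2)).

Let lift_rel (U : lmodType K) (f : V -> W -> U) r :
  bilinear_for *:%R *:%R f ->
  tensor_rel r -> malg_lift (fun p => f p.1 p.2) r = 0.
Proof.
case=> fl fr [[a [v [v' [w ->]]]]|[a [v [w [w' ->]]]]];
  rewrite linearB/= linearP/= !malg_liftU !scale1r/=; apply/eqP; rewrite subr_eq0; apply/eqP.
  exact: fl.
exact: fr.
Qed.

Let liftE (U : lmodType K) (f : V -> W -> U) v w :
  bilinear_for *:%R *:%R f -> lift f (pure v w) = f v w.
Proof.
move=> fB; rewrite /lift /pure lquot_liftE/= ?malg_liftU ?scale1r// => r.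
exact: lift_rel.
Qed.

Let lift_linear (U : lmodType K) (f : V -> W -> U) :
  bilinear_for *:%R *:%R f -> linear (lift f).
Proof. by move=> fB; apply: lquot_lift_is_linear => r; exact: lift_rel. Qed.

Let ext (U : lmodType K) (f g : {linear lquot tensor_rel -> U}) :
  (forall v w, f (pure v w) = g (pure v w)) -> f =1 g.
Proof.
move=> fg x; rewrite -[x]lreprK [lrepr x]monalgE !raddf_sum.
apply: eq_bigr => -[v w] _ /=; set a := _ @_ _.
have -> : << a *g (v, w) >> = a *: gen v w.
  by apply/malgP => k; rewrite mcoeffZ !mcoeffU mulrnAr mulr1.
by rewrite !linearZ; congr (_ *: _); exact: fg.
Qed.

Definition tensor_product_construction : tensor_product V W.
Proof. exact: (TensorProduct pure_bilinear lift_linear liftE (@ext)). Qed.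
End TensorConstruction.

Section Tensor.
Variables (K : fieldType) (V W : lmodType K).

Definition tensor : lmodType K := tp_space (tensor_product_construction V W).
Definition tpure : V -> W -> tensor :=
  @tp_pure _ _ _ (tensor_product_construction V W).
Definition tlift (U : lmodType K) : (V -> W -> U) -> tensor -> U :=
  @tp_lift _ _ _ (tensor_product_construction V W) U.

HB.instance Definition _ := bilinear_isBilinear.Build K V W tensor *:%R *:%R
  tpure (tp_pure_bilinear (tensor_product_construction V W)).

Fact tpure_is_linear v : linear (tpure v).
Proof. exact: (tp_pure_bilinear (tensor_product_construction V W)).2. Qed.
HB.instance Definition _ v :=
  GRing.isLinear.Build K W tensor *:%R (tpure v) (tpure_is_linear v).
End Tensor.
Arguments tpure {K V W}.
Arguments tlift {K V W U}.

Notation "V \ox W" := (tensor V W) (at level 40, left associativity).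
Notation "v \ot w" := (tpure v w) (at level 40, left associativity) : ring_scope.

Section TensorTheory.
Variables (K : fieldType) (V W U : lmodType K).

Lemma tliftE (f : V -> W -> U) v w :
  bilinear_for *:%R *:%R f -> tlift f (v \ot w) = f v w.
Proof. exact: tp_liftE. Qed.

Lemma tlift_linear (f : V -> W -> U) :
  bilinear_for *:%R *:%R f -> linear (tlift f).
Proof. exact: tp_lift_linear. Qed.

Lemma tensor_ext (f g : {linear V \ox W -> U}) :
  (forall v w, f (v \ot w) = g (v \ot w)) -> f =1 g.
Proof. exact: tp_ext. Qed.

Lemma eq_tlift (f g : V -> W -> U) : f =2 g -> tlift f =1 tlift g.
Proof. by move=> fg; have -> : f = g by apply/funext => v; apply/funext. Qed.

Lemma tensor_eq (f g : V \ox W -> U) : linear f -> linear g ->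
  (forall v w, f (v \ot w) = g (v \ot w)) -> f =1 g.
Proof.
move=> fL gL; pose F := GRing.isLinear.Build K (V \ox W) U *:%R f fL.
pose G := GRing.isLinear.Build K (V \ox W) U *:%R g gL.
exact: (tensor_ext (f := HB.pack_for {linear V \ox W -> U} f F)
                   (g := HB.pack_for {linear V \ox W -> U} g G)).
Qed.

Lemma tlift_param_linear (I : lmodType K) (f : I -> V -> W -> U) :
  (forall i, bilinear_for *:%R *:%R (f i)) ->
  (forall v w, linear (fun i => f i v w)) ->
  forall x, linear (fun i => tlift (f i) x).
Proof.
move=> fB fI x a i j; move: x; apply: tensor_eq => [|b x y|v w].
- exact: tlift_linear.
- by rewrite !(tlift_linear (fB _)) !scalerDr !scalerA (mulrC a) addrACA.
- by rewrite !tliftE//; exact: fI.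
Qed.
End TensorTheory.
Section TensorMaps.
Variables (K : fieldType).

Section Map.
Variables (V V' W W' : lmodType K).

Definition tmap (f : V -> V') (g : W -> W') : V \ox W -> V' \ox W' :=
  tlift (fun v w => f v \ot g w).

Variables (f : {linear V -> V'}) (g : {linear W -> W'}).

Fact tmap_bilinear : bilinear_for *:%R *:%R (fun v w => f v \ot g w).
Proof.
split=> [w a v v'|v a w w']; rewrite /= /applyr linearP; first exact: linearPl.
exact: linearPr.
Qed.

Lemma tmapE v w : tmap f g (v \ot w) = f v \ot g w.
Proof. exact: tliftE tmap_bilinear. Qed.

Fact tmap_is_linear : linear (tmap f g).
Proof. exact: tlift_linear tmap_bilinear. Qed.
HB.instance Definition _ :=
  GRing.isLinear.Build K (V \ox W) (V' \ox W') *:%R (tmap f g) tmap_is_linear.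
End Map.

(* The tensor product of two bilinear maps, as a map
   (U \ox V) x (U' \ox V') -> U'' \ox V''. *)
Definition tmap2 (U V U' V' U'' V'' : lmodType K)
    (f : U -> U' -> U'') (g : V -> V' -> V'')
    (x : U \ox V) (y : U' \ox V') : U'' \ox V'' :=
  tlift (fun u v => tlift (fun u' v' => f u u' \ot g v v') y) x.

Section Assoc.
Variables (U V W : lmodType K).

Definition tassoc : (U \ox V) \ox W -> U \ox (V \ox W) :=
  tlift (fun x w => tlift (fun u v => u \ot (v \ot w)) x).

Definition tassocV : U \ox (V \ox W) -> (U \ox V) \ox W :=
  tlift (fun u y => tlift (fun v w => (u \ot v) \ot w) y).

Let bil (w : W) : bilinear_for *:%R *:%R
  (fun (u : U) (v : V) => u \ot (v \ot w)).
Proof.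
split=> [v a u u'|u a v v']; rewrite /= /applyr; first exact: linearPl.
by rewrite linearPl linearPr.
Qed.

Let bilV (u : U) : bilinear_for *:%R *:%R
  (fun (v : V) (w : W) => (u \ot v) \ot w).
Proof.
split=> [w a v v'|v a w w']; rewrite /= /applyr; last exact: linearPr.
by rewrite linearPr linearPl.
Qed.

Fact tassoc_bilinear : bilinear_for *:%R *:%R
  (fun (x : U \ox V) (w : W) => tlift (fun u v => u \ot (v \ot w)) x).
Proof.
split=> [w|x]; first exact: tlift_linear (bil w).
rewrite /=; apply: (tlift_param_linear (f := fun w u v => u \ot (v \ot w)) bil) => u v a w w'.
by rewrite !linearPr.
Qed.

Fact tassocV_bilinear : bilinear_for *:%R *:%R
  (fun (u : U) (y : V \ox W) => tlift (fun v w => (u \ot v) \ot w) y).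
Proof.
split=> [y|u]; last exact: tlift_linear (bilV u).
rewrite /applyr; apply: (tlift_param_linear (f := fun u v w => (u \ot v) \ot w) bilV) => v w a u u'.
by rewrite !linearPl.
Qed.

Fact tassoc_is_linear : linear tassoc.
Proof. exact: tlift_linear tassoc_bilinear. Qed.
HB.instance Definition _ :=
  GRing.isLinear.Build K ((U \ox V) \ox W) (U \ox (V \ox W)) *:%R tassoc
    tassoc_is_linear.

Fact tassocV_is_linear : linear tassocV.
Proof. exact: tlift_linear tassocV_bilinear. Qed.
HB.instance Definition _ :=
  GRing.isLinear.Build K (U \ox (V \ox W)) ((U \ox V) \ox W) *:%R tassocV
    tassocV_is_linear.

Lemma tassocE u v w : tassoc ((u \ot v) \ot w) = u \ot (v \ot w).
Proof. by rewrite /tassoc (tliftE _ _ tassoc_bilinear) (tliftE _ _ (bil w)). Qed.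

Lemma tassocVE u v w : tassocV (u \ot (v \ot w)) = (u \ot v) \ot w.
Proof. by rewrite /tassocV (tliftE _ _ tassocV_bilinear) (tliftE _ _ (bilV u)). Qed.

Lemma tensor_ext3l (X : lmodType K) (f g : {linear (U \ox V) \ox W -> X}) :
  (forall u v w, f ((u \ot v) \ot w) = g ((u \ot v) \ot w)) -> f =1 g.
Proof.
move=> fg; apply: tensor_ext => x w; move: x.
by apply: (tensor_ext (f := f \o applyr tpure w) (g := g \o applyr tpure w)) => u v; exact: fg.
Qed.

Lemma tensor_ext3r (X : lmodType K) (f g : {linear U \ox (V \ox W) -> X}) :
  (forall u v w, f (u \ot (v \ot w)) = g (u \ot (v \ot w))) -> f =1 g.
Proof.
move=> fg; apply: tensor_ext => u.
by apply: (tensor_ext (f := f \o tpure u) (g := g \o tpure u)) => v w; exact: fg.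
Qed.

Lemma tassocK : cancel tassoc tassocV.
Proof.
apply: (tensor_ext3l (f := tassocV \o tassoc) (g := idfun)) => u v w /=.
by rewrite tassocE tassocVE.
Qed.

Lemma tassocVK : cancel tassocV tassoc.
Proof.
apply: (tensor_ext3r (f := tassoc \o tassocV) (g := idfun)) => u v w /=.
by rewrite tassocVE tassocE.
Qed.
End Assoc.
End TensorMaps.
Arguments tassoc {K U V W}.
Arguments tassocV {K U V W}.

Section TensorMapTheory.
Variable K : fieldType.
Implicit Types U V W : lmodType K.

Lemma eq_tmap V V' W W' (f f' : V -> V') (g g' : W -> W') :
  f =1 f' -> g =1 g' -> tmap f g =1 tmap f' g'.
Proof. by move=> ff' gg'; apply: eq_tlift => v w; rewrite ff' gg'. Qed.

Lemma tmap_id V W : tmap (@idfun V) (@idfun W) =1 idfun.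
Proof.
apply: (tensor_ext (f := tmap (@idfun V) (@idfun W)) (g := idfun)) => v w.
exact: tmapE.
Qed.

Lemma tmap_comp V V' V'' W W' W'' (f : {linear V -> V'}) (f' : {linear V' -> V''})
    (g : {linear W -> W'}) (g' : {linear W' -> W''}) x :
  tmap f' g' (tmap f g x) = tmap (f' \o f) (g' \o g) x.
Proof.
move: x.
apply: (tensor_ext (f := tmap f' g' \o tmap f g) (g := tmap (f' \o f) (g' \o g))).
by move=> v w /=; rewrite !tmapE.
Qed.

Lemma tmap_comp_eq V V1 V2 V' W W1 W2 W' (f : {linear V -> V1}) (f' : {linear V1 -> V'})
    (g : {linear W -> W1}) (g' : {linear W1 -> W'}) (k : {linear V -> V2})
    (k' : {linear V2 -> V'}) (l : {linear W -> W2}) (l' : {linear W2 -> W'}) x :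
  (forall v, f' (f v) = k' (k v)) -> (forall w, g' (g w) = l' (l w)) ->
  tmap f' g' (tmap f g x) = tmap k' l' (tmap k l x).
Proof. by move=> fk gl; rewrite !tmap_comp; apply: eq_tmap. Qed.

Lemma tassoc_nat U U' V V' W W' (f : {linear U -> U'}) (g : {linear V -> V'})
    (h : {linear W -> W'}) x :
  tassoc (tmap (tmap f g) h x) = tmap f (tmap g h) (tassoc x).
Proof.
move: x; apply: (tensor_ext3l (f := tassoc \o tmap (tmap f g) h)
                              (g := tmap f (tmap g h) \o tassoc)) => u v w /=.
by rewrite !(tassocE, tmapE)/= !tmapE tassocE.
Qed.

Lemma tassocV_nat U U' V V' W W' (f : {linear U -> U'}) (g : {linear V -> V'})
    (h : {linear W -> W'}) x :
  tassocV (tmap f (tmap g h) x) = tmap (tmap f g) h (tassocV x).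
Proof.
move: x; apply: (tensor_ext3r (f := tassocV \o tmap f (tmap g h))
                              (g := tmap (tmap f g) h \o tassocV)) => u v w /=.
by rewrite !(tassocVE, tmapE)/= !tmapE tassocVE.
Qed.

Lemma tmap0l V V' W W' (f : {linear V -> V'}) (g : {linear W -> W'}) x :
  (forall v, f v = 0) -> tmap f g x = 0.
Proof.
move=> f0; move: x; apply: (tensor_ext (f := tmap f g) (g := \0)) => v w /=.
by rewrite tmapE f0 linear0l.
Qed.

Lemma tmap0r V V' W W' (f : {linear V -> V'}) (g : {linear W -> W'}) x :
  (forall w, g w = 0) -> tmap f g x = 0.
Proof.
move=> g0; move: x; apply: (tensor_ext (f := tmap f g) (g := \0)) => v w /=.
by rewrite tmapE g0 linear0.
Qed.
End TensorMapTheory.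

(* The composites e \ot id : V \ox W -> K \ox W = W and
   id \ot e : V \ox W -> V \ox K = V. *)
Section TensorForm.
Variables (K : fieldType) (V W : lmodType K).

Definition tforml (e : V -> K) : V \ox W -> W := tlift (fun v w => e v *: w).
Definition tformr (e : W -> K) : V \ox W -> V := tlift (fun v w => e w *: v).

Section Left.
Variable e : {scalar V}.

Let bil : bilinear_for *:%R *:%R (fun (v : V) (w : W) => e v *: w).
Proof.
split=> [w|v] a x y /=; rewrite /applyr/=.
  by rewrite linearP scalerDl scalerA.
by rewrite linearP.
Qed.

Lemma tformlE v w : tforml e (v \ot w) = e v *: w.
Proof. exact: tliftE bil. Qed.

Fact tforml_is_linear : linear (tforml e).
Proof. exact: tlift_linear bil. Qed.
HB.instance Definition _ :=
  GRing.isLinear.Build K (V \ox W) W *:%R (tforml e) tforml_is_linear.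
End Left.

Section Right.
Variable e : {scalar W}.

Let bil : bilinear_for *:%R *:%R (fun (v : V) (w : W) => e w *: v).
Proof.
split=> [w|v] a x y /=; rewrite /applyr/=.
  by rewrite linearP.
by rewrite linearP scalerDl scalerA.
Qed.

Lemma tformrE v w : tformr e (v \ot w) = e w *: v.
Proof. exact: tliftE bil. Qed.

Fact tformr_is_linear : linear (tformr e).
Proof. exact: tlift_linear bil. Qed.
HB.instance Definition _ :=
  GRing.isLinear.Build K (V \ox W) V *:%R (tformr e) tformr_is_linear.
End Right.
End TensorForm.

Section TensorFormTheory.
Variables (K : fieldType) (V W W' : lmodType K) (e : {scalar V}) (g : {linear W -> W'}).

Lemma tforml_nat x : tforml e (tmap idfun g x) = g (tforml e x).
Proof.
move: x; apply: (tensor_ext (f := tforml e \o tmap idfun g)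
                            (g := g \o tforml e)) => v w /=.
by rewrite tmapE !tformlE linearZ.
Qed.

Lemma tformr_nat x : tformr e (tmap g idfun x) = g (tformr e x).
Proof.
move: x; apply: (tensor_ext (f := tformr e \o tmap g idfun)
                            (g := g \o tformr e)) => w v /=.
by rewrite tmapE !tformrE linearZ.
Qed.
End TensorFormTheory.


HB.mixin Record Lmodule_isCoalgebra (K : fieldType) C of GRing.Lmodule K C := {
  coprod : {linear C -> C \ox C};
  counit : {scalar C};
  coprodA : forall c,
    tassoc (tmap coprod idfun (coprod c)) = tmap idfun coprod (coprod c);
  counitl : forall c, tforml counit (coprod c) = c;
  counitr : forall c, tformr counit (coprod c) = c
}.
#[short(type="coalgType")]
HB.structure Definition Coalgebra (K : fieldType) :=
  {C of GRing.Lmodule K C & Lmodule_isCoalgebra K C}.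

HB.mixin Record Algebra_Coalgebra_isBialgebra (K : fieldType) A
    of GRing.Algebra K A & Coalgebra K A := {
  coprod1 : coprod (1 : A) = 1 \ot 1;
  coprodM : forall a b : A, coprod (a * b) = tmap2 *%R *%R (coprod a) (coprod b);
  counit1 : counit (1 : A) = 1;
  counitM : forall a b : A, counit (a * b) = counit a * counit b
}.
#[short(type="bialgType")]
HB.structure Definition Bialgebra (K : fieldType) :=
  {A of GRing.Algebra K A & Coalgebra K A & Algebra_Coalgebra_isBialgebra K A}.

HB.mixin Record Bialgebra_isHopfAlgebra (K : fieldType) H of Bialgebra K H := {
  antipode : {linear H -> H};
  antipodel : forall h : H,
    tlift (fun x y => antipode x * y) (coprod h) = counit h *: 1;
  antipoder : forall h : H,
    tlift (fun x y => x * antipode y) (coprod h) = counit h *: 1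
}.
#[short(type="hopfAlgType")]
HB.structure Definition HopfAlgebra (K : fieldType) :=
  {H of Bialgebra K H & Bialgebra_isHopfAlgebra K H}.

(* tmap idfun coprod (coprod t) is t_1 \ot (t_2 \ot t_3). *)
Definition ad_coinvariant_integral (K : fieldType) (H : hopfAlgType K) (t : H) : Prop :=
  [/\ forall h : H, h * t = counit h *: t,
      tlift (fun t1 t23 => tlift (fun t2 t3 => (t1 * antipode t3) \ot t2) t23)
            (tmap idfun coprod (coprod t))
        = (1 : H) \ot t
    & counit t = 1].

Definition coalgebra_hom (K : fieldType) (C D : coalgType K) (f : {linear C -> D}) : Prop :=
  (forall c, coprod (f c) = tmap f f (coprod c)) /\
  (forall c, counit (f c) = counit c).

Section Coradical.
Variables (K : fieldType) (E : coalgType K).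

Definition subcoalgebra (D : {pred E}) : Prop :=
  submod_closed D /\
  forall x, x \in D ->
    coprod x \in lspan [set z | exists a b, [/\ a \in D, b \in D & z = a \ot b]].

Definition simple_subcoalgebra (D : {pred E}) : Prop :=
  [/\ subcoalgebra D,
      exists2 x, x \in D & x != 0
    & forall D' : {pred E}, subcoalgebra D' -> {subset D' <= D} ->
        (forall x, x \in D' -> x = 0) \/ {subset D <= D'}].

Definition corad : {pred E} :=
  lspan [set x | exists2 D, simple_subcoalgebra D & x \in D].
End Coradical.
Arguments corad {K} E.

Record bicomodule (K : fieldType) (C : coalgType K) := Bicomodule {
  bicomod_space :> lmodType K;
  lcoact : {linear bicomod_space -> C \ox bicomod_space};
  rcoact : {linear bicomod_space -> bicomod_space \ox C};
  lcoactA : forall x,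
    tassoc (tmap coprod idfun (lcoact x)) = tmap idfun lcoact (lcoact x);
  lcoact1 : forall x, tforml counit (lcoact x) = x;
  rcoactA : forall x,
    tassoc (tmap rcoact idfun (rcoact x)) = tmap idfun coprod (rcoact x);
  rcoact1 : forall x, tformr counit (rcoact x) = x;
  lrcoact : forall x,
    tassoc (tmap lcoact idfun (rcoact x)) = tmap idfun rcoact (lcoact x)
}.

Definition bicomodule_hom (K : fieldType) (C : coalgType K) (X Y : bicomodule C)
    (f : {linear X -> Y}) : Prop :=
  (forall x, lcoact Y (f x) = tmap idfun f (lcoact X x)) /\
  (forall x, rcoact Y (f x) = tmap f idfun (rcoact X x)).

(* Injectivity relative to the bicomodule maps with a K-linear retraction, which
   need not be a bicomodule map. *)
Definition relatively_injective (K : fieldType) (C : coalgType K) (Q : bicomodule C) : Prop :=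
  forall (X Y : bicomodule C) (i : {linear X -> Y}),
    bicomodule_hom i -> (exists r : {linear Y -> X}, cancel i r) ->
  forall g : {linear X -> Q}, bicomodule_hom g ->
  exists2 h : {linear Y -> Q}, bicomodule_hom h & forall x, h (i x) = g x.

Section CokerCoprod.
Variables (K : fieldType) (C : coalgType K).
Local Notation coprod := (@coprod K C).

(* C \ox C with the coactions coprod \ot id and id \ot coprod. *)
Definition cofree_lcoact : {linear C \ox C -> C \ox (C \ox C)} :=
  tassoc \o tmap coprod idfun.
Definition cofree_rcoact : {linear C \ox C -> (C \ox C) \ox C} :=
  tassocV \o tmap idfun coprod.

Let tassocr (b : C) (x : C \ox C) : tassoc (x \ot b) = tmap idfun (applyr tpure b) x.
Proof.
move: x; apply: (tensor_ext (f := tassoc \o applyr tpure b)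
                            (g := tmap idfun (applyr tpure b))) => u v /=.
by rewrite tassocE tmapE.
Qed.

Let tassocVl (a : C) (x : C \ox C) : tassocV (a \ot x) = tmap (tpure a) idfun x.
Proof.
move: x; apply: (tensor_ext (f := tassocV \o tpure a)
                            (g := tmap (tpure a) idfun)) => u v /=.
by rewrite tassocVE tmapE.
Qed.

Lemma cofree_lcoactE a b : cofree_lcoact (a \ot b) = tmap idfun (applyr tpure b) (coprod a).
Proof. by rewrite /= tmapE tassocr. Qed.

Lemma cofree_rcoactE a b : cofree_rcoact (a \ot b) = tmap (tpure a) idfun (coprod b).
Proof. by rewrite /= tmapE tassocVl. Qed.

Fact cofree_lcoactA x :
  tassoc (tmap coprod idfun (cofree_lcoact x)) = tmap idfun cofree_lcoact (cofree_lcoact x).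
Proof.
move: x; apply: (tensor_ext (f := tassoc \o (tmap coprod idfun \o cofree_lcoact))
                            (g := tmap idfun cofree_lcoact \o cofree_lcoact)) => a b.
rewrite [LHS]/= [RHS]/= !tmapE/= !tassocr.
transitivity (tassoc (tmap (tmap idfun idfun) (applyr tpure b) (tmap coprod idfun (coprod a)))).
  by congr tassoc; apply: tmap_comp_eq => //= v; rewrite tmap_id.
rewrite tassoc_nat coprodA; apply: tmap_comp_eq => //= v.
by rewrite tmapE/= tassocr.
Qed.

Fact cofree_rcoactA x :
  tassoc (tmap cofree_rcoact idfun (cofree_rcoact x)) = tmap idfun coprod (cofree_rcoact x).
Proof.
move: x; apply: (tensor_ext (f := tassoc \o (tmap cofree_rcoact idfun \o cofree_rcoact))
                            (g := tmap idfun coprod \o cofree_rcoact)) => a b.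
rewrite [LHS]/= [RHS]/= !tmapE/= !tassocVl.
transitivity (tassoc (tmap (tmap (tpure a) idfun) idfun (tmap coprod idfun (coprod b)))).
  by congr tassoc; apply: tmap_comp_eq => //= v; rewrite tmapE/= tassocVl.
rewrite tassoc_nat coprodA; apply: tmap_comp_eq => //= v.
by rewrite tmap_id.
Qed.

Fact cofree_lrcoact x :
  tassoc (tmap cofree_lcoact idfun (cofree_rcoact x))
    = tmap idfun cofree_rcoact (cofree_lcoact x).
Proof.
have coh (y : (C \ox C) \ox (C \ox C)) :
    tassoc (tmap tassoc idfun (tassocV y)) = tmap idfun tassocV (tassoc y).
  move: y; apply: (tensor_ext (f := tassoc \o (tmap tassoc idfun \o tassocV))
                              (g := tmap idfun tassocV \o tassoc)) => u v.
  move: v; apply: (tensor_ext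
    (f := (tassoc \o (tmap tassoc idfun \o tassocV)) \o tpure u)
    (g := (tmap idfun tassocV \o tassoc) \o tpure u)) => c d.
  move: u; apply: (tensor_ext
    (f := (tassoc \o (tmap tassoc idfun \o tassocV)) \o applyr tpure (c \ot d))
    (g := (tmap idfun tassocV \o tassoc) \o applyr tpure (c \ot d))) => a b /=.
  by rewrite !(tassocVE, tassocE, tmapE)/= !(tassocVE, tassocE, tmapE).
transitivity (tassoc (tmap tassoc idfun (tassocV (tmap coprod coprod x)))).
  transitivity (tassoc (tmap tassoc idfun
    (tmap (tmap coprod idfun) idfun (tassocV (tmap idfun coprod x))))).
    by congr tassoc; rewrite [RHS]tmap_comp.
  congr (tassoc (tmap _ _ _)); rewrite -tassocV_nat; congr tassocV.
  by rewrite tmap_comp; apply: eq_tmap => //= v /=; rewrite tmap_id.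
rewrite coh.
transitivity (tmap idfun tassocV
    (tmap idfun (tmap idfun coprod) (tassoc (tmap coprod idfun x)))); last first.
  by rewrite [LHS]tmap_comp.
congr tmap; rewrite -tassoc_nat; congr tassoc.
by rewrite tmap_comp; apply: eq_tmap => //= v /=; rewrite tmap_id.
Qed.

Fact cofree_lcoact1 x : tforml counit (cofree_lcoact x) = x.
Proof.
move: x; apply: (tensor_ext (f := tforml counit \o cofree_lcoact) (g := idfun)) => a b.
by rewrite [LHS]/= tmapE/= tassocr tforml_nat counitl.
Qed.

Fact cofree_rcoact1 x : tformr counit (cofree_rcoact x) = x.
Proof.
move: x; apply: (tensor_ext (f := tformr counit \o cofree_rcoact) (g := idfun)) => a b.
by rewrite [LHS]/= tmapE/= tassocVl tformr_nat counitr.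
Qed.

Definition cofree_bicomodule : bicomodule C :=
  Bicomodule cofree_lcoactA cofree_lcoact1 cofree_rcoactA cofree_rcoact1 cofree_lrcoact.

(* Coker coprod, with the coactions induced by those of C \ox C. *)
Definition coker_space : lmodType K := lquot (range coprod).
Definition coker_proj : {linear C \ox C -> coker_space} := lproj (range coprod).

Let coker_proj_coprod c : coker_proj (coprod c) = 0.
Proof. by apply/eqP; rewrite lproj_eq0 sub_lspan//; exists c. Qed.

Definition coker_lcoact : coker_space -> C \ox coker_space :=
  lquot_lift (tmap idfun coker_proj \o cofree_lcoact).
Definition coker_rcoact : coker_space -> coker_space \ox C :=
  lquot_lift (tmap coker_proj idfun \o cofree_rcoact).

Let lcoact_ker z : range coprod z -> (tmap idfun coker_proj \o cofree_lcoact) z = 0.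
Proof.
case=> c _ <-; rewrite [LHS]/= coprodA tmap_comp; apply: tmap0r => a /=.
exact: coker_proj_coprod.
Qed.

Let rcoact_ker z : range coprod z -> (tmap coker_proj idfun \o cofree_rcoact) z = 0.
Proof.
case=> c _ <-; rewrite [LHS]/= -coprodA tassocK tmap_comp; apply: tmap0l => a /=.
exact: coker_proj_coprod.
Qed.

Fact coker_lcoact_is_linear : linear coker_lcoact.
Proof. exact: lquot_lift_is_linear lcoact_ker. Qed.
HB.instance Definition _ :=
  GRing.isLinear.Build K coker_space (C \ox coker_space) *:%R coker_lcoact
    coker_lcoact_is_linear.

Fact coker_rcoact_is_linear : linear coker_rcoact.
Proof. exact: lquot_lift_is_linear rcoact_ker. Qed.
HB.instance Definition _ :=
  GRing.isLinear.Build K coker_space (coker_space \ox C) *:%R coker_rcoact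
    coker_rcoact_is_linear.

Lemma coker_lcoactE z :
  coker_lcoact (coker_proj z) = tmap idfun coker_proj (cofree_lcoact z).
Proof. exact: lquot_liftE lcoact_ker. Qed.

Lemma coker_rcoactE z :
  coker_rcoact (coker_proj z) = tmap coker_proj idfun (cofree_rcoact z).
Proof. exact: lquot_liftE rcoact_ker. Qed.

Fact coker_lcoactA q :
  tassoc (tmap coprod idfun (coker_lcoact q)) = tmap idfun coker_lcoact (coker_lcoact q).
Proof.
rewrite -[q]lreprK; set z := lrepr q; rewrite coker_lcoactE.
transitivity (tassoc (tmap (tmap idfun idfun) coker_proj
                           (tmap coprod idfun (cofree_lcoact z)))).
  by congr tassoc; apply: tmap_comp_eq => //= v; rewrite tmap_id.
rewrite tassoc_nat cofree_lcoactA; apply: tmap_comp_eq => // v.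
exact/esym/coker_lcoactE.
Qed.

Fact coker_rcoactA q :
  tassoc (tmap coker_rcoact idfun (coker_rcoact q)) = tmap idfun coprod (coker_rcoact q).
Proof.
rewrite -[q]lreprK; set z := lrepr q; rewrite coker_rcoactE.
transitivity (tassoc (tmap (tmap coker_proj idfun) idfun
                           (tmap cofree_rcoact idfun (cofree_rcoact z)))).
  by congr tassoc; apply: tmap_comp_eq => // v; exact: coker_rcoactE.
rewrite tassoc_nat cofree_rcoactA; apply: tmap_comp_eq => //= v.
by rewrite tmap_id.
Qed.

Fact coker_lrcoact q :
  tassoc (tmap coker_lcoact idfun (coker_rcoact q))
    = tmap idfun coker_rcoact (coker_lcoact q).
Proof.
rewrite -[q]lreprK; set z := lrepr q; rewrite coker_rcoactE coker_lcoactE.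
transitivity (tassoc (tmap (tmap idfun coker_proj) idfun
                           (tmap cofree_lcoact idfun (cofree_rcoact z)))).
  by congr tassoc; apply: tmap_comp_eq => // v; exact: coker_lcoactE.
rewrite tassoc_nat cofree_lrcoact; apply: tmap_comp_eq => // v.
exact/esym/coker_rcoactE.
Qed.

Fact coker_lcoact1 q : tforml counit (coker_lcoact q) = q.
Proof. by rewrite -[q]lreprK coker_lcoactE tforml_nat cofree_lcoact1. Qed.

Fact coker_rcoact1 q : tformr counit (coker_rcoact q) = q.
Proof. by rewrite -[q]lreprK coker_rcoactE tformr_nat cofree_rcoact1. Qed.

Definition coker_coprod : bicomodule C :=
  Bicomodule coker_lcoactA coker_lcoact1 coker_rcoactA coker_rcoact1 coker_lrcoact.
End CokerCoprod.

Definition formally_smooth (K : fieldType) (C : coalgType K) : Prop :=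
  relatively_injective (coker_coprod C).

(* The coalgebras in the monoidal category of right H-modules, then of
   H-bimodules: coprod and counit are H-linear for the diagonal actions on
   E \ox E and the action of H on K through its counit. *)
Record rmodule_coalgebra (K : fieldType) (H : bialgType K) := RModuleCoalgebra {
  rmc_coalg :> coalgType K;
  ract : rmc_coalg -> H -> rmc_coalg;
  ract_bilinear : bilinear_for *:%R *:%R ract;
  ract1 : forall e, ract e 1 = e;
  ractM : forall e h k, ract e (h * k) = ract (ract e h) k;
  coprod_ract : forall e h, coprod (ract e h) = tmap2 ract ract (coprod e) (coprod h);
  counit_ract : forall e h, counit (ract e h) = counit e * counit h
}.

Record bimodule_coalgebra (K : fieldType) (H : bialgType K) := BimoduleCoalgebra {
  bmc_rmc :> rmodule_coalgebra H;
  lact : H -> bmc_rmc -> bmc_rmc;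
  lact_bilinear : bilinear_for *:%R *:%R lact;
  lact1 : forall e, lact 1 e = e;
  lactM : forall h k e, lact (h * k) e = lact h (lact k e);
  lractA : forall h e k, ract (lact h e) k = lact h (ract e k);
  coprod_lact : forall h e, coprod (lact h e) = tmap2 lact lact (coprod h) (coprod e);
  counit_lact : forall h e, counit (lact h e) = counit h * counit e
}.

Definition rmodule_coalgebra_hom (K : fieldType) (H : bialgType K)
    (E F : rmodule_coalgebra H) (f : {linear E -> F}) : Prop :=
  coalgebra_hom f /\ forall e h, f (ract e h) = ract (f e) h.

Definition bimodule_coalgebra_hom (K : fieldType) (H : bialgType K)
    (E F : bimodule_coalgebra H) (f : {linear E -> F}) : Prop :=
  rmodule_coalgebra_hom f /\ forall h e, f (lact h e) = lact h (f e).

Section Regular.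
Variables (K : fieldType) (H : bialgType K).

Fact mul_bilinear : bilinear_for *:%R *:%R ( *%R : H -> H -> H).
Proof.
split=> h a x y; rewrite /applyr/=; first by rewrite mulrDl scalerAl.
by rewrite mulrDr scalerAr.
Qed.

Definition regular_rmodule_coalgebra : rmodule_coalgebra H :=
  @RModuleCoalgebra K H H *%R mul_bilinear (@mulr1 H) (@mulrA H)
    (@coprodM K H) (@counitM K H).

Definition regular_bimodule_coalgebra : bimodule_coalgebra H :=
  @BimoduleCoalgebra K H regular_rmodule_coalgebra *%R mul_bilinear (@mul1r H)
    (fun h k e => esym (mulrA h k e)) (fun h e k => esym (mulrA h e k))
    (@coprodM K H) (@counitM K H).
End Regular.

(* Main.v *)
(* Let i : H -> E be the inclusion. E is exhausted by F_0 = i(H) and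
   F_(n+1) = F_n wedge F_0, because the coefficients of the simple subquotients of E lie
   in its coradical. The coalgebra map is the limit of H-linear counital retractions rho
   whose curvature coprod rho - (rho \ox rho) coprod vanishes on F_n. Smoothness gives a
   coderivation D : H \ox H \ox H -> H splitting the cobar differential; as the curvature
   is a 2-cocycle, subtracting D applied to curvature \ox rho makes the curvature vanish on
   F_(n+1), up to terms which are quadratic in it and vanish there. This correction need
   not be H-linear, but it is determined by a linear equation that survives averaging with
   the Casimir element t_1 \ot S(t_2): ad-coinvariance of t says precisely that averaging
   is compatible with coproducts. *)
From HB Require Import structures.
Require Import Defs.
From mathcomp Require Import all_boot all_algebra.
From mathcomp Require Import boolp classical_sets.

Set Implicit Arguments.
Unset Strict Implicit.
Unset Printing Implicit Defensive.

Import GRing.Theory.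

Local Open Scope classical_set_scope.
Local Open Scope ring_scope.

(** * Subspaces of a vector space *)

Section Packing.
Variables (K : fieldType) (V W : lmodType K).

(** Being a coalgebra map is a quadratic condition, so a coalgebra retraction built without regard
    to the actions cannot be averaged at the end. Equivariance is therefore imposed at every stage:
    once [rho] is equivariant, the conditions [corrects i n rho g] are affine in [g], and only
    solutions of these are averaged. The start is a linear retraction of [i], made counital and then
    averaged; its curvature vanishes on F_0 because it splits the coalgebra map [i]. The wedge has
    the following effect: a tensor of two maps, the first killing F_n and the second F_0, kills the
    coproducts of F_(n+1). This disposes of both quadratic terms, curvature \ot curvature when
    solving for [g], and [g] \ot [g] in the curvature of [rho] + [g]. The induction is run for an
    abstract class [P] of maps, so that it serves one action as well as two commuting ones. The
    limit is not claimed to lie in [P]: it agrees on every finite set with a member of [P], which is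
    enough for equivariance, an equality between values at two points. *)

Definition linear_of (f : V -> W) (fL : linear f) : {linear V -> W} :=
  let M := GRing.isLinear.Build K V W *:%R f fL in HB.pack_for {linear V -> W} f M.

Definition scalar_of (f : V -> K) (fL : scalar f) : {scalar V} :=
  let M := GRing.isLinear.Build K V K *%R f fL in HB.pack_for {scalar V} f M.
End Packing.

Section Subspaces.
Variables (K : fieldType) (V : lmodType K).
Implicit Types (A B W : V -> Prop) (s : seq V).

Definition subspace W := W 0 /\ forall (a : K) x y, W x -> W y -> W (a *: x + y).

Lemma subspace0 W : subspace W -> W 0. Proof. by case. Qed.

Lemma subspaceZ W a x : subspace W -> W x -> W (a *: x).
Proof. by move=> [W0 WL] Wx; rewrite -[_ *: _]addr0; exact: WL. Qed.

Lemma subspaceD W x y : subspace W -> W x -> W y -> W (x + y).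
Proof. by move=> [_ WL] Wx Wy; rewrite -[x]scale1r; exact: WL. Qed.

Lemma subspaceB W x y : subspace W -> W x -> W y -> W (x - y).
Proof. by move=> [_ WL] Wx Wy; rewrite addrC -scaleN1r; exact: WL. Qed.

Lemma subspace_sum W (I : Type) (r : seq I) (F : I -> V) :
  subspace W -> (forall i, W (F i)) -> W (\sum_(i <- r) F i).
Proof.
move=> sW WF; elim/big_rec: _ => [|i x _ Wx]; first exact: subspace0.
exact: subspaceD.
Qed.

Lemma subspace_lspan (S : set V) : subspace (fun x => x \in lspan S).
Proof. by case: (lspan_submod S) => S0 SL; split=> // a x y; exact: SL. Qed.

Lemma lspan_subspace (S : set V) W x :
  subspace W -> (forall y, S y -> W y) -> x \in lspan S -> W x.
Proof.
move=> [W0 WL] SW /lspanP/(_ (fun y => `[< W y >])) xS; apply/asboolP/xS.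
  split=> [|a y z /asboolP Wy /asboolP Wz]; apply/asboolP => //; exact: WL.
by move=> y Sy; apply/asboolP/SW.
Qed.

(** Finite-dimensional subspaces are spans of lists; the length of the list bounds the dimension,
    and no basis is ever chosen. *)
Fixpoint span_seq s : V -> Prop :=
  if s is y :: s' then fun x => exists k z, span_seq s' z /\ x = k *: y + z
  else fun x => x = 0.

Lemma span_seq_subspace s : subspace (span_seq s).
Proof.
elim: s => [|y s [s0 sL]] /=; first by split=> // a x y -> ->; rewrite scaler0 addr0.
split; first by exists 0, 0; rewrite scale0r addr0.
move=> a _ _ [k [z [sz ->]]] [l [w [sw ->]]].
exists (a * k + l), (a *: z + w); split; first exact: sL.
by rewrite scalerDr scalerDl scalerA addrACA.
Qed.

Lemma span_seq_mem s x : x \in s -> span_seq s x.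
Proof.
elim: s => // y s IH; rewrite inE => /predU1P[->|/IH sx] /=.
  by exists 1, 0; rewrite scale1r addr0; split=> //; case: (span_seq_subspace s).
by exists 0, x; rewrite scale0r add0r.
Qed.

Lemma span_seq_sub s W : subspace W -> (forall x, x \in s -> W x) ->
  forall x, span_seq s x -> W x.
Proof.
move=> sW; elim: s => [|y s IH] sWm x /=; first by move=> ->; exact: subspace0.
move=> [k [z [sz ->]]]; case: (sW) => _; apply; first by apply: sWm; rewrite mem_head.
by apply: IH sz => w ws; apply: sWm; rewrite inE ws orbT.
Qed.

(** Gaussian elimination: if some [w] in [W] involves the head [y], it replaces [y] as a generator,
    and the other elements of [W] are reduced modulo [w] into the span of the tail. *)
Lemma span_seq_subspaceP s W : subspace W -> (forall x, W x -> span_seq s x) ->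
  exists2 s', (size s' <= size s)%N & forall x, W x <-> span_seq s' x.
Proof.
elim: s W => [|y s IH] W sW Ws.
  by exists [::] => // x; split=> [/Ws//|->]; exact: subspace0.
pose W1 x := W x /\ span_seq s x.
have sW1 : subspace W1.
  case: (sW) (span_seq_subspace s) => W0 WL [s0 sL].
  by split=> [|a x z [? ?] [? ?]]; split=> //; [exact: WL|exact: sL].
have [s' ss' W1s'] := IH W1 sW1 (fun x => @proj2 _ _).
have [[w [Ww nsw]]|nW] := pselect (exists w, W w /\ ~ span_seq s w); last first.
  exists s' => [|x]; first exact: leqW.
  rewrite -W1s'; split=> [Wx|[]//]; split=> //.
  by apply: contrapT => nsx; apply: nW; exists x.
have [k [z [sz wE]]] := Ws w Ww.
have k0 : k != 0 by apply/eqP => k0; apply: nsw; rewrite wE k0 scale0r add0r.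
exists (w :: s') => // x /=; split=> [Wx|[l [v [/W1s'[Wv _] ->]]]]; last first.
  by case: sW => _; apply.
have [l [v [sv xE]]] := Ws x Wx; exists (l / k), (x - (l / k) *: w); split; last first.
  by rewrite addrC subrK.
apply/W1s'; split; first by apply: subspaceB => //; exact: subspaceZ.
rewrite xE wE scalerDr scalerA divfK// opprD addrACA subrr add0r.
by have ss := span_seq_subspace s; apply: subspaceB => //; exact: subspaceZ.
Qed.

(** The strict drop is what makes a choice with fewest generators minimal for inclusion in the
    exhaustion argument. *)
Lemma span_seq_proper s W : subspace W -> (forall x, W x -> span_seq s x) ->
  (exists2 x, span_seq s x & ~ W x) ->
  exists2 s', (size s' < size s)%N & forall x, W x <-> span_seq s' x.
Proof.
elim: s W => [|y s IH] W sW Ws [u us nWu].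
  by case: nWu; move: us => /= ->; exact: subspace0.
pose W1 x := W x /\ span_seq s x.
have sW1 : subspace W1.
  case: (sW) (span_seq_subspace s) => W0 WL [s0 sL].
  by split=> [|a x z [? ?] [? ?]]; split=> //; [exact: WL|exact: sL].
have [[w [Ww nsw]]|nW] := pselect (exists w, W w /\ ~ span_seq s w); last first.
  have Ws1 x : W x -> span_seq s x.
    by move=> Wx; apply: contrapT => nsx; apply: nW; exists x.
  by have [s' ss' Ws'] := span_seq_subspaceP sW Ws1; exists s'.
have [k [z [sz wE]]] := Ws w Ww.
have k0 : k != 0 by apply/eqP => k0; apply: nsw; rewrite wE k0 scale0r add0r.
have red x : span_seq (y :: s) x -> exists l, span_seq s (x - l *: w).
  move=> [l [v [sv xE]]]; exists (l / k).
  rewrite xE wE scalerDr scalerA divfK// opprD addrACA subrr add0r.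
  by have ss := span_seq_subspace s; apply: subspaceB => //; exact: subspaceZ.
(* A witness outside [W] stays outside after subtracting a multiple of [w], so properness passes to
   the span of the tail. *)
have [l sul] := red u us.
have nW1 : exists2 x, span_seq s x & ~ W1 x.
  exists (u - l *: w) => // -[Wul _]; apply: nWu; rewrite -(subrK (l *: w) u).
  by apply: subspaceD => //; exact: subspaceZ.
have [s' ss' W1s'] := IH W1 sW1 (fun x => @proj2 _ _) nW1.
exists (w :: s') => // x /=; split=> [Wx|[m [v [/W1s'[Wv _] ->]]]]; last first.
  by case: sW => _; apply.
have [m sxm] := red x (Ws x Wx); exists m, (x - m *: w); split; last by rewrite addrC subrK.
by apply/W1s'; split => //; apply: subspaceB => //; exact: subspaceZ.
Qed.

(** A subspace [Q] containing [B] and maximal among those meeting [A] only in 0 is a complement of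
    [A]; [f] is the projection along [Q]. *)
Lemma exists_projection A B : subspace A -> subspace B ->
  (forall x, A x -> B x -> x = 0) ->
  exists f : {linear V -> V},
    [/\ forall x, A (f x), forall x, A x -> f x = x & forall x, B x -> f x = 0].
Proof.
move=> sA sB AB0.
pose good Q := [/\ subspace Q, (forall x, B x -> Q x) & forall x, A x -> Q x -> x = 0].
have goodB : good B by [].
have [|Q [PQ Qmax]] := @Zorn_bigcup V (fun Q => Q = set0 \/ good Q).
  move=> F FP Ftot; have [[X0 FX0 gX0]|nF] := pselect (exists2 X, F X & good X); last first.
    left; apply/seteqP; split=> // x [X FX Xx].
    case: (FP _ FX) => [X0|gX]; first by rewrite X0 in Xx.
    by case: nF; exists X.
  right; split.
  - split=> [|a x y [X FX Xx] [Y FY Yy]]; first by exists X0 => //; case: gX0 => -[].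
    have gX : good X by case: (FP _ FX) => // X0'; rewrite X0' in Xx.
    have gY : good Y by case: (FP _ FY) => // X0'; rewrite X0' in Yy.
    have [XY|YX] := Ftot _ _ FX FY; [exists Y => //|exists X => //].
      by case: gY => -[_ YL] _ _; apply: YL => //; exact: XY.
    by case: gX => -[_ XL] _ _; apply: XL => //; exact: YX.
  - by move=> x Bx; exists X0 => //; case: gX0 => _ + _; apply.
  - move=> x Ax [X FX Xx]; case: (FP _ FX) => [X0'|[_ _]]; last exact.
    by rewrite X0' in Xx.
have {PQ}[sQ BQ AQ0] : good Q.
  case: PQ => // Q0; case: (Qmax B); last by right.
  by rewrite Q0; split=> // /(_ 0)/=; apply; exact: subspace0.
have dec v : exists p, A p /\ Q (v - p).
  apply: contrapT => nv.
  (* If [v] had no decomposition, [Q] + [K v] would contradict maximality: an element k v + q of [A]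
     with [k] nonzero, divided by [k], is an [A]-part for [v]. *)
  pose Q' x := exists k q, Q q /\ x = k *: v + q.
  apply: (Qmax Q'); first split.
  - by move=> q Qq; exists 0, q; rewrite scale0r add0r.
  - move=> /(_ v) Qv; apply: nv; exists 0; rewrite subr0; split; first exact: subspace0.
    by apply: Qv; exists 1, 0; rewrite scale1r addr0; split=> //; exact: subspace0.
  right; split.
  - split=> [|a _ _ [k [q [Qq ->]]] [l [r [Qr ->]]]].
      by exists 0, 0; rewrite scale0r addr0; split=> //; exact: subspace0.
    exists (a * k + l), (a *: q + r); split; first by case: sQ => _; apply.
    by rewrite scalerDr scalerDl scalerA addrACA.
  - by move=> x /BQ Qx; exists 0, x; rewrite scale0r add0r.
  - move=> x Ax [k [q [Qq xE]]]; have [k0|k0] := eqVneq k 0.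
      by apply: AQ0 => //; rewrite xE k0 scale0r add0r.
    case: nv; exists (k^-1 *: x); split; first exact: subspaceZ.
    rewrite xE scalerDr scalerA mulVf// scale1r opprD addrA subrr add0r -scaleN1r scalerA.
    exact: subspaceZ.
have [f fP] := choice dec.
have uniq v p : A p -> Q (v - p) -> f v = p.
  move=> Ap Qp; have [Af Qf] := fP v; apply/eqP; rewrite -subr_eq0; apply/eqP/AQ0.
    exact: subspaceB.
  have -> : f v - p = (v - p) - (v - f v) by rewrite opprB [RHS]addrC addrA subrK.
  exact: subspaceB.
have f_linear : linear f.
  move=> a x y; have [[Ax Qx] [Ay Qy]] := (fP x, fP y).
  apply: uniq; first by case: sA => _; apply.
  have -> : a *: x + y - (a *: f x + f y) = a *: (x - f x) + (y - f y).
    by rewrite opprD addrACA scalerBr.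
  by case: sQ => _; apply.
exists (linear_of f_linear); split=> x /=.
- by case: (fP x).
- by move=> Ax; apply: uniq => //; rewrite subrr; exact: subspace0.
- by move=> Bx; apply: uniq; [exact: subspace0|rewrite subr0; exact: BQ].
Qed.
End Subspaces.

(** * Linear forms separate points of spaces and of tensor products *)

Section Separation.
Variable K : fieldType.
Implicit Types V W : lmodType K.

(** The form is the coordinate of the projection onto the line [K x] that kills [A]. *)
Lemma separating_form V (A : V -> Prop) x : subspace A -> ~ A x ->
  exists2 f : {scalar V}, forall y, A y -> f y = 0 & f x = 1.
Proof.
move=> sA nAx; have x0 : x != 0 by apply/eqP => x0; apply: nAx; rewrite x0; case: sA.
have xI (a b : K) : a *: x = b *: x -> a = b.
  move/eqP; rewrite -subr_eq0 -scalerBl scaler_eq0 (negPf x0) orbF subr_eq0.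
  by move/eqP.
pose X y := exists a : K, y = a *: x.
have sX : subspace X.
  split=> [|a _ _ [b ->] [c ->]]; first by exists 0; rewrite scale0r.
  by exists (a * b + c); rewrite scalerDl scalerA.
have XA0 y : X y -> A y -> y = 0.
  case=> a -> Aax; have [->|a0] := eqVneq a 0; first by rewrite scale0r.
  by case: nAx; rewrite -[x]scale1r -(mulVf a0) -scalerA; exact: subspaceZ.
have [f [fX fid fA]] := exists_projection sX sA XA0.
have [g gP] := choice fX.
have g_scalar : scalar g.
  by move=> a y z; apply: xI; rewrite -gP linearP !gP scalerDl scalerA.
exists (scalar_of g_scalar) => [y Ay|] /=; apply: xI; rewrite -gP.
  by rewrite fA// scale0r.
by rewrite scale1r; apply: fid; exists 1; rewrite scale1r.
Qed.

Lemma form_eq0 V (x : V) : (forall f : {scalar V}, f x = 0) -> x = 0.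
Proof.
move=> fx0; apply: contrapT => x0.
have s0 : subspace (fun y : V => y = 0) by split=> // a y z -> ->; rewrite scaler0 addr0.
by have [f _ fx1] := separating_form s0 x0; move/eqP: fx1; rewrite fx0 eq_sym oner_eq0.
Qed.

Lemma tensorP V W (z : V \ox W) : exists s : seq (V * W),
  z = \sum_(p <- s) p.1 \ot p.2.
Proof.
pose S : set (V \ox W) := [set z | exists v w, z = v \ot w].
have : z \in lspan S.
  rewrite -lproj_eq0; apply/eqP; move: z.
  apply: (tensor_ext (f := lproj S) (g := \0)) => v w /=.
  by apply/eqP; rewrite lproj_eq0; apply: sub_lspan; exists v, w.
apply: (@lspan_subspace _ _ _ (fun z => exists s, z = _)) => [|_ [v [w ->]]]; last by exists [:: (v, w)]; rewrite big_seq1.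
split=> [|a _ _ [s ->] [s' ->]]; first by exists [::]; rewrite big_nil.
exists ([seq (a *: p.1, p.2) | p <- s] ++ s'); rewrite big_cat big_map/= scaler_sumr.
by congr (_ + _); apply: eq_bigr => p _; rewrite linearZl_LR.
Qed.

Lemma tensor_absorb V W (v : V) (w : W) (s : seq (V * W)) :
  span_seq [seq p.2 | p <- s] w ->
  exists2 s', size s' = size s &
    v \ot w + \sum_(p <- s) p.1 \ot p.2 = \sum_(p <- s') p.1 \ot p.2.
Proof.
elim: s w => [|[v1 w1] s IH] w /= => [->|[k [w' [/IH[s' ss' sE] ->]]]].
  by exists [::] => //; rewrite linear0 add0r.
exists ((v1 + k *: v, w1) :: s'); first by rewrite /= ss'.
rewrite !big_cons/= -sE linearDr linearDl linearZr_LR linearZl_LR.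
by rewrite addrACA [k *: _ + _]addrC.
Qed.

(** Induction on the number of pure tensors. If the second factor [w] of the first one depends on
    the others, it is absorbed; otherwise a form equal to 1 at [w] and 0 at the others shows that
    its first factor is 0. *)
Lemma tformr_eq0 V W (z : V \ox W) : (forall g : {scalar W}, tformr g z = 0) -> z = 0.
Proof.
have [s ->] := tensorP z; move: {2}(size s) (leqnn (size s)) => n.
elim: n s => [|n IH] [|[v w] s] // sn z0; rewrite ?big_nil//.
have [/(tensor_absorb v)[s' ss' sE]|nw] :=
    pselect (span_seq [seq p.2 | p <- s] w).
  rewrite big_cons/= sE; apply: IH => [|g]; first by rewrite ss'.
  by rewrite -sE -(z0 g) big_cons.
have [g gs gw] := separating_form (span_seq_subspace _) nw.
have v0 : v = 0.
  rewrite -(z0 g) big_cons linearD/= tformrE gw scale1r linear_sum big_seq big1/= ?addr0//.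
  move=> p sp; rewrite tformrE gs ?scale0r//; exact/span_seq_mem/map_f.
have sE : \sum_(p <- (v, w) :: s) p.1 \ot p.2 = \sum_(p <- s) p.1 \ot p.2.
  by rewrite big_cons/= v0 linear0l add0r.
by rewrite sE; apply: IH => // h; rewrite -sE.
Qed.

Lemma tforml_eq0 V W (z : V \ox W) : (forall g : {scalar V}, tforml g z = 0) -> z = 0.
Proof.
move=> z0; apply: tformr_eq0 => h; apply: form_eq0 => g.
have -> : g (tformr h z) = h (tforml g z).
  have [s ->] := tensorP z; rewrite !linear_sum; apply: eq_bigr => p _ /=.
  by rewrite tformrE tformlE !linearZ/= mulrC.
by rewrite z0 linear0.
Qed.
End Separation.

(** * Sums over tensors *)

Section TensorSums.
Variable K : fieldType.
Implicit Types U V W X : lmodType K.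

(** A bare proposition, so that Sweedler integrands need no packed structure and the tactic [lin]
    can settle side conditions from their shape. *)
Definition lin V U (f : V -> U) : Prop := linear f.
Definition slin V (f : V -> K) : Prop := scalar f.
Definition bilin V W U (F : V -> W -> U) : Prop :=
  (forall w, lin (F^~ w)) /\ (forall v, lin (F v)).

Lemma bilinW V W U (F : V -> W -> U) : bilin F -> bilinear_for *:%R *:%R F.
Proof. by case. Qed.

Definition tdec V W (z : V \ox W) : seq (V * W) := sval (cid (tensorP z)).

Lemma tdecE V W (z : V \ox W) : z = \sum_(p <- tdec z) p.1 \ot p.2.
Proof. by rewrite /tdec; case: cid. Qed.

(** A sum over a decomposition fixed by choice. Its value is canonical only for bilinear [F], but as
    a plain finite sum it obeys congruence, exchange and additivity for every [F]. *)
Definition tsum V W U (z : V \ox W) (F : V -> W -> U) : U :=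
  \sum_(p <- tdec z) F p.1 p.2.

Lemma tsumE V W U (z : V \ox W) (F : V -> W -> U) : bilin F -> tsum z F = tlift F z.
Proof.
move=> Fb; pose G := linear_of (tlift_linear (bilinW Fb)).
rewrite -[RHS]/(G z) [z in RHS]tdecE linear_sum; apply: eq_bigr => p _ /=.
by rewrite tliftE//; exact: bilinW.
Qed.

Lemma tsum_pure V W U (F : V -> W -> U) v w : bilin F -> tsum (v \ot w) F = F v w.
Proof. by move=> Fb; rewrite tsumE// tliftE//; exact: bilinW. Qed.

Lemma eq_tsum V W U (z : V \ox W) (F G : V -> W -> U) :
  (forall v w, F v w = G v w) -> tsum z F = tsum z G.
Proof. by move=> FG; apply: eq_bigr => p _. Qed.

Lemma lin_tsum V W U U' (z : V \ox W) (F : V -> W -> U) (f : U -> U') :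
  lin f -> f (tsum z F) = tsum z (fun v w => f (F v w)).
Proof. by move=> fL; rewrite -[f]/(linear_of fL : _ -> _) linear_sum. Qed.

Lemma slin_tsum V W U (z : V \ox W) (F : V -> W -> U) (f : {scalar U}) :
  f (tsum z F) = \sum_(p <- tdec z) f (F p.1 p.2).
Proof. by rewrite linear_sum. Qed.

Lemma exchange_tsum V W V' W' U (z : V \ox W) (y : V' \ox W')
    (F : V -> W -> V' -> W' -> U) :
  tsum z (fun a b => tsum y (F a b)) = tsum y (fun c d => tsum z (fun a b => F a b c d)).
Proof. exact: exchange_big. Qed.

Lemma tsumD V W U (z : V \ox W) (F G : V -> W -> U) :
  tsum z (fun v w => F v w + G v w) = tsum z F + tsum z G.
Proof. exact: big_split. Qed.

Lemma tsumN V W U (z : V \ox W) (F : V -> W -> U) :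
  tsum z (fun v w => - F v w) = - tsum z F.
Proof. exact: sumrN. Qed.

Lemma tsumB V W U (z : V \ox W) (F G : V -> W -> U) :
  tsum z (fun v w => F v w - G v w) = tsum z F - tsum z G.
Proof. by rewrite tsumD tsumN. Qed.

Lemma tsum0 V W U (z : V \ox W) : tsum z (fun _ _ => 0 : U) = 0.
Proof. exact: big1_eq. Qed.

Lemma tsum_tpure V W (z : V \ox W) : tsum z tpure = z.
Proof. by rewrite [RHS]tdecE. Qed.

Lemma lin_id V : lin (fun x : V => x). Proof. by []. Qed.
Lemma lin_linear V U U' (f : {linear U -> U'}) (g : V -> U) :
  lin g -> lin (fun x => f (g x)).
Proof. by move=> gL a x y; rewrite gL linearP. Qed.
Lemma lin_comp V U U' (f : U -> U') (g : V -> U) : lin f -> lin g -> lin (fun x => f (g x)).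
Proof. by move=> fL gL a x y; rewrite gL fL. Qed.
Lemma lin_purel V W U (f : V -> W) (u : U) : lin f -> lin (fun x => f x \ot u).
Proof. by move=> fL a x y; rewrite fL linearPl. Qed.
Lemma lin_purer V W U (f : V -> W) (u : U) : lin f -> lin (fun x => u \ot f x).
Proof. by move=> fL a x y; rewrite fL linearPr. Qed.
Lemma lin_scalel V U (h : V -> K) (u : U) : slin h -> lin (fun x => h x *: u).
Proof. by move=> hL a x y; rewrite hL scalerDl scalerA. Qed.
Lemma lin_scaler V U (f : V -> U) (k : K) : lin f -> lin (fun x => k *: f x).
Proof. by move=> fL a x y; rewrite fL scalerDr !scalerA mulrC. Qed.
Lemma lin_tsumr V V' W' U (z : V' \ox W') (F : V -> V' -> W' -> U) :
  (forall v w, lin (fun x => F x v w)) -> lin (fun x => tsum z (F x)).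
Proof.
move=> FL a x y; rewrite /tsum scaler_sumr -big_split/=; apply: eq_bigr => p _.
exact: FL.
Qed.
Lemma lin_tsuml V V' W' U (f : V -> V' \ox W') (F : V' -> W' -> U) :
  lin f -> bilin F -> lin (fun x => tsum (f x) F).
Proof.
move=> fL Fb a x y; rewrite !tsumE// fL.
exact: (tlift_linear (bilinW Fb)).
Qed.
Lemma slin_scalar V U (h : {scalar U}) (f : V -> U) : lin f -> slin (fun x => h (f x)).
Proof. by move=> fL a x y; rewrite fL linearP. Qed.

Lemma tsum_tmap V V' W W' U (f : {linear V -> V'}) (g : {linear W -> W'}) z
    (F : V' -> W' -> U) : bilin F ->
  tsum (tmap f g z) F = tsum z (fun v w => F (f v) (g w)).
Proof.
move=> Fb; have [Fl Fr] := Fb.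
rewrite tsumE// [z in LHS]tdecE linear_sum/=.
pose G := linear_of (tlift_linear (bilinW Fb)).
rewrite -[LHS]/(G _) linear_sum; apply: eq_bigr => p _ /=.
by rewrite tmapE tliftE//; exact: bilinW.
Qed.
End TensorSums.

Section Lalg.
Variables (K : fieldType) (A : algType K) (V : lmodType K).
Lemma lin_mull (f : V -> A) (c : A) : lin f -> lin (fun x => f x * c).
Proof. by move=> fL a x y; rewrite fL mulrDl scalerAl. Qed.
Lemma lin_mulr (f : V -> A) (c : A) : lin f -> lin (fun x => c * f x).
Proof. by move=> fL a x y; rewrite fL mulrDr scalerAr. Qed.
End Lalg.

(** The guards against [fun x => x] keep the composition rules from applying to their own output for
    ever. *)
Ltac lin_step :=
  cbv beta;
  first
  [ assumption
  | solve [auto]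
  | match goal with
    | |- bilin _ => split; intro
    | |- forall _, _ => intro
    | |- lin (fun x => x) => exact: lin_id
    | |- lin (fun x => @?f x \ot ?u) => apply: (@lin_purel _ _ _ _ f u)
    | |- lin (fun x => ?u \ot @?f x) => apply: (@lin_purer _ _ _ _ f u)
    | |- lin (fun x => @?f x * ?u) => apply: (@lin_mull _ _ _ f u)
    | |- lin (fun x => ?u * @?f x) => apply: (@lin_mulr _ _ _ f u)
    | |- lin (fun x => ?k *: (@?f x)) => apply: (@lin_scaler _ _ _ f k)
    | |- lin (fun x => @?h x *: ?u) => apply: (@lin_scalel _ _ _ h u)
    | |- lin (fun x => tsum ?z (@?F x)) => apply: (@lin_tsumr _ _ _ _ _ z F)
    | |- lin (fun x => tsum (@?f x) ?F) => apply: (@lin_tsuml _ _ _ _ _ f F)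
    | |- lin (fun x => GRing.Linear.sort ?h (@?f x)) => apply: (@lin_linear _ _ _ _ h f)
    | |- slin (fun x => GRing.Linear.sort ?h (@?f x)) => apply: (@slin_scalar _ _ _ h f)
    | |- lin (fun x => ?h (@?f x)) =>
        lazymatch f with fun x => x => fail | _ => idtac end;
        apply: (@lin_comp _ _ _ _ h f)
    | |- lin (fun x => ?h x) => first [exact: linearP | solve [auto]]
    | |- lin (fun x => ?h (@?f x) ?b) =>
        lazymatch f with fun x => x => fail | _ => idtac end;
        apply: (@lin_comp _ _ _ _ (fun v => h v b) f)
    | |- lin (fun x => ?h (@?f x) ?b ?c) =>
        lazymatch f with fun x => x => fail | _ => idtac end;
        apply: (@lin_comp _ _ _ _ (fun v => h v b c) f)
    | |- @lin ?K ?V ?U ?f => lazymatch f with fun x => _ => fail | _ => idtac end; change (@lin K V U (fun x => f x))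
    end ].
Ltac lin := repeat lin_step.

Definition trilin (K : fieldType) (V W X U : lmodType K) (F : V -> W -> X -> U) : Prop :=
  [/\ forall w x, lin (fun v => F v w x), forall v x, lin (fun w => F v w x)
    & forall v w, lin (F v w)].

Ltac trilin := split; lin.

Section Sweedler.
Variable K : fieldType.
Implicit Types (C D : coalgType K) (V W X U : lmodType K).

Lemma tsum_tassoc V W X U (z : (V \ox W) \ox X) (F : V -> W -> X -> U) : trilin F ->
  tsum (tassoc z) (fun a y => tsum y (F a)) = tsum z (fun x d => tsum x (fun a b => F a b d)).
Proof.
move=> [F1 F2 F3].
have [bl br] : bilin (fun a y => tsum y (F a)) /\ bilin (fun x d => tsum x (fun a b => F a b d)).
  by split; lin.
rewrite !tsumE//.
pose g := linear_of (tlift_linear (bilinW bl)).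
pose h := linear_of (tlift_linear (bilinW br)).
rewrite -[LHS]/((g \o tassoc) z) -[RHS]/(h z); move: z.
apply: tensor_ext3l => u v w /=; rewrite tassocE !tliftE; [|exact: bilinW..].
by rewrite !tsum_pure//; split; lin.
Qed.

Lemma coprod_assoc C U (c : C) (F : C -> C -> C -> U) : trilin F ->
  tsum (coprod c) (fun x y => tsum (coprod x) (fun a b => F a b y)) =
  tsum (coprod c) (fun a x => tsum (coprod x) (F a)).
Proof.
move=> Ft; have [F1 F2 F3] := Ft.
transitivity (tsum (tmap idfun coprod (coprod c)) (fun a y => tsum y (F a))).
  rewrite -coprodA tsum_tassoc// tsum_tmap//; by lin.
by rewrite tsum_tmap//; lin.
Qed.

Lemma tformr_tsum V W (h : {scalar W}) (z : V \ox W) :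
  tformr h z = tsum z (fun a b => h b *: a).
Proof. by rewrite tsumE//; lin. Qed.

Lemma tforml_tsum V W (h : {scalar V}) (z : V \ox W) :
  tforml h z = tsum z (fun a b => h a *: b).
Proof. by rewrite tsumE//; lin. Qed.

Lemma coprod_counitl C U (c : C) (f : C -> U) : lin f ->
  tsum (coprod c) (fun a b => counit a *: f b) = f c.
Proof.
move=> fL; rewrite -[c in RHS]counitl tforml_tsum lin_tsum//; apply: eq_tsum => a b.
by rewrite -[f]/(linear_of fL : _ -> _) linearZ.
Qed.

Lemma coprod_counitr C U (c : C) (f : C -> U) : lin f ->
  tsum (coprod c) (fun a b => counit b *: f a) = f c.
Proof.
move=> fL; rewrite -[c in RHS]counitr tformr_tsum lin_tsum//; apply: eq_tsum => a b.
by rewrite -[f]/(linear_of fL : _ -> _) linearZ.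
Qed.

Lemma tmapE_tsum V V' W W' (f : {linear V -> V'}) (g : {linear W -> W'}) z :
  tmap f g z = tsum z (fun v w => f v \ot g w).
Proof. by rewrite -[LHS]tsum_tpure tsum_tmap//; lin. Qed.

Lemma tsum_coalgebra_hom C D U (f : {linear C -> D}) c (F : D -> D -> U) :
  coalgebra_hom f -> bilin F ->
  tsum (coprod (f c)) F = tsum (coprod c) (fun a b => F (f a) (f b)).
Proof. by move=> [-> _] Fb; rewrite tsum_tmap. Qed.

Lemma tsum_tmap2 V W V' W' V'' W'' U (f : V -> V' -> V'') (g : W -> W' -> W'')
    x y (F : V'' -> W'' -> U) : bilin f -> bilin g -> bilin F ->
  tsum (tmap2 f g x y) F =
  tsum x (fun u v => tsum y (fun u' v' => F (f u u') (g v v'))).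
Proof.
move=> [f1 f2] [g1 g2] [F1 F2].
have b1 u v : bilin (fun u' v' => f u u' \ot g v v').
  split=> [w|w].
    by apply: (@lin_comp _ _ _ _ (fun t => t \ot g v w) (f u)); [lin|].
  by apply: (@lin_comp _ _ _ _ (fun t => f u w \ot t) (g v)); [lin|].
have E1 z : tlift (fun u v => tlift (fun u' v' => f u u' \ot g v v') z) x
          = tlift (fun u v => tsum z (fun u' v' => f u u' \ot g v v')) x.
  by apply: eq_tlift => u v; rewrite tsumE.
rewrite /tmap2 E1 -tsumE; last first.
  split=> w; apply: lin_tsumr => v v'.
    by apply: (@lin_comp _ _ _ _ (fun t => t \ot g w v') (f^~ v)); [lin|].
  by apply: (@lin_comp _ _ _ _ (fun t => f w v \ot t) (g^~ v')); [lin|].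
have L : lin (fun z => tsum z F) by apply: lin_tsuml => //; exact: lin_id.
rewrite (lin_tsum _ _ L); apply: eq_tsum => u v; rewrite (lin_tsum _ _ L).
by apply: eq_tsum => u' v'; rewrite tsum_pure.
Qed.
End Sweedler.

Section SweedlerHopf.
Variables (K : fieldType) (U : lmodType K).

Lemma bilin_mul (A : algType K) : bilin ( *%R : A -> A -> A).
Proof. by lin. Qed.

Lemma tsum_coprodM (H : bialgType K) (a b : H) (F : H -> H -> U) : bilin F ->
  tsum (coprod (a * b)) F =
  tsum (coprod a) (fun x y => tsum (coprod b) (fun u v => F (x * u) (y * v))).
Proof. by move=> Fb; rewrite coprodM tsum_tmap2//; exact: bilin_mul. Qed.

Lemma tsum_coprod1 (H : bialgType K) (F : H -> H -> U) : bilin F ->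
  tsum (coprod (1 : H)) F = F 1 1.
Proof. by move=> Fb; rewrite coprod1 tsum_pure. Qed.

Lemma tsum_antipodel (H : hopfAlgType K) (h : H) (f : H -> U) : lin f ->
  tsum (coprod h) (fun a b => f (antipode a * b)) = counit h *: f 1.
Proof.
move=> fL; rewrite -lin_tsum// tsumE; last by lin.
by rewrite antipodel -[f]/(linear_of fL : _ -> _) linearZ.
Qed.

Lemma tsum_antipoder (H : hopfAlgType K) (h : H) (f : H -> U) : lin f ->
  tsum (coprod h) (fun a b => f (a * antipode b)) = counit h *: f 1.
Proof.
move=> fL; rewrite -lin_tsum// tsumE; last by lin.
by rewrite antipoder -[f]/(linear_of fL : _ -> _) linearZ.
Qed.
End SweedlerHopf.

(** * Coradical filtration *)

Lemma scalerCA (K : fieldType) (V : lmodType K) (a b : K) (v : V) :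
  a *: (b *: v) = b *: (a *: v).
Proof. by rewrite !scalerA mulrC. Qed.

(** * The two actions of the dual algebra on a coalgebra *)

Section Hits.
Variables (K : fieldType) (E : coalgType K).
Implicit Types (f g h : {scalar E}) (e : E) (W D : E -> Prop).

(** The element e_1 h(e_2); the name records the leg that is kept. *)
Definition hitl h e : E := tformr h (coprod e).
Definition hitr f e : E := tforml f (coprod e).

Fact hitl_is_linear h : linear (hitl h).
Proof. exact: (linearP (tformr h \o coprod)). Qed.
HB.instance Definition _ h := GRing.isLinear.Build K E E *:%R (hitl h) (hitl_is_linear h).

Fact hitr_is_linear f : linear (hitr f).
Proof. exact: (linearP (tforml f \o coprod)). Qed.
HB.instance Definition _ f := GRing.isLinear.Build K E E *:%R (hitr f) (hitr_is_linear f).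

Lemma hitlE h e : hitl h e = tsum (coprod e) (fun a b => h b *: a).
Proof. exact: tformr_tsum. Qed.

Lemma hitrE f e : hitr f e = tsum (coprod e) (fun a b => f a *: b).
Proof. exact: tforml_tsum. Qed.

Lemma hitl_counit e : hitl counit e = e. Proof. exact: counitr. Qed.
Lemma hitr_counit e : hitr counit e = e. Proof. exact: counitl. Qed.

Lemma hitlC h f e : hitl h (hitr f e) = hitr f (hitl h e).
Proof.
rewrite [hitr f e]hitrE [hitl h e]hitlE !lin_tsum; try exact: linearP.
transitivity (tsum (coprod e) (fun a y => tsum (coprod y) (fun b c => f a *: (h c *: b)))).
  by apply: eq_tsum => a b; rewrite linearZ/= hitlE lin_tsum//; lin.
rewrite -coprod_assoc; last by trilin.
apply: eq_tsum => x c; rewrite linearZ/= hitrE lin_tsum; last by lin.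
by apply: eq_tsum => a b; exact: scalerCA.
Qed.

Lemma hitl_hitl f h e : hitl f (hitl h e) = hitl (f \o hitl h) e.
Proof.
rewrite [hitl h e]hitlE lin_tsum; last exact: linearP.
transitivity (tsum (coprod e) (fun y c => tsum (coprod y) (fun a b => h c *: (f b *: a)))).
  by apply: eq_tsum => a b; rewrite linearZ/= hitlE lin_tsum//; lin.
rewrite coprod_assoc; last by trilin.
rewrite hitlE; apply: eq_tsum => a x /=; rewrite hitlE.
rewrite slin_tsum scaler_suml; apply: eq_bigr => p _.
by rewrite [in RHS]linearZ/=; exact: scalerA.
Qed.

Lemma hitr_hitr g f e : hitr g (hitr f e) = hitr (g \o hitr f) e.
Proof.
rewrite [hitr f e]hitrE lin_tsum; last exact: linearP.
transitivity (tsum (coprod e) (fun a y => tsum (coprod y) (fun b c => f a *: (g b *: c)))).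
  by apply: eq_tsum => a b; rewrite linearZ/= hitrE lin_tsum//; lin.
rewrite -coprod_assoc; last by trilin.
rewrite hitrE; apply: eq_tsum => x c /=; rewrite hitrE.
rewrite slin_tsum scaler_suml; apply: eq_bigr => p _.
by rewrite [in RHS]linearZ/=; exact: scalerA.
Qed.

Lemma hitlr f h e : f (hitl h e) = h (hitr f e).
Proof.
rewrite hitlE hitrE !slin_tsum; apply: eq_bigr => p _.
by rewrite !linearZ/= mulrC.
Qed.

(** For a subspace [W] over a field this means that [coprod] maps [W] into W \ot E: a right coideal.
    [rstable] is the mirror notion. *)
Definition lstable W := forall h e, W e -> W (hitl h e).
Definition rstable W := forall f e, W e -> W (hitr f e).

Lemma hitr_ann W f w : lstable W -> (forall x, W x -> f x = 0) -> W w -> hitr f w = 0.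
Proof. by move=> sW fW Ww; apply: form_eq0 => h; rewrite -hitlr fW//; exact: sW. Qed.

Lemma hitl_ann W h w : rstable W -> (forall x, W x -> h x = 0) -> W w -> hitl h w = 0.
Proof. by move=> sW hW Ww; apply: form_eq0 => f; rewrite hitlr hW//; exact: sW. Qed.

Lemma subcoalgebra_stable (D : {pred E}) : subcoalgebra D ->
  [/\ subspace (fun x => x \in D), lstable (fun x => x \in D) & rstable (fun x => x \in D)].
Proof.
move=> [[D0 DL] DD].
have sD : subspace (fun x => x \in D) by split=> // a x y; exact: DL.
have pre (U : lmodType K) (g : {linear U -> E}) : subspace (fun x => g x \in D).
  by split=> [|a x y]; rewrite ?linear0 ?linearP//; exact: DL.
split=> // h e /DD De.
- apply: (lspan_subspace (pre _ (tformr h)) _ De) => _ [a [b [Da Db ->]]].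
  by rewrite /= tformrE; apply: (subspaceZ _ sD).
- apply: (lspan_subspace (pre _ (tforml h)) _ De) => _ [a [b [Da Db ->]]].
  by rewrite /= tformlE; apply: (subspaceZ _ sD).
Qed.

(** A projection [p] onto [D], applied to either leg of [coprod x], changes nothing, as forms on the
    other leg show; hence [coprod x] equals its image under p \ot p. *)
Lemma stable_subcoalgebra (D : {pred E}) :
  subspace (fun x => x \in D) -> lstable (fun x => x \in D) -> rstable (fun x => x \in D) ->
  subcoalgebra D.
Proof.
move=> sD lD rD; split=> [|x Dx].
  by case: sD => D0 DL; split=> // a x y; exact: DL.
have s0 : subspace (fun x : E => x = 0).
  by split=> // a u v -> ->; rewrite scaler0 addr0.
have [p [pD pid _]] := exists_projection sD s0 (fun x _ => id).
have pl : tmap p idfun (coprod x) = coprod x.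
  apply/eqP; rewrite -subr_eq0; apply/eqP/tformr_eq0 => h.
  by rewrite linearB/= tformr_nat pid ?subrr//; exact: lD.
have pr : tmap idfun p (coprod x) = coprod x.
  apply/eqP; rewrite -subr_eq0; apply/eqP/tforml_eq0 => f.
  by rewrite linearB/= tforml_nat pid ?subrr//; exact: rD.
have -> : coprod x = tmap p p (coprod x).
  by rewrite -[LHS]pl -[in LHS]pr tmap_comp.
rewrite tmapE_tsum; apply: (subspace_sum _ (subspace_lspan _)) => i.
by apply: sub_lspan; exists (p i.1), (p i.2).
Qed.
End Hits.

Lemma subspace_preim (K : fieldType) (U V : lmodType K) (g : {linear U -> V}) (W : V -> Prop) :
  subspace W -> subspace (fun x => W (g x)).
Proof. by case=> W0 WL; split=> [|a x y]; rewrite ?linear0 ?linearP//; exact: WL. Qed.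

Lemma subspaceI (K : fieldType) (V : lmodType K) (A B : V -> Prop) :
  subspace A -> subspace B -> subspace (fun x => A x /\ B x).
Proof.
move=> [A0 AL] [B0 BL]; split=> // a x y [Ax Bx] [Ay By].
by split; [exact: AL|exact: BL].
Qed.

(** * Simple right coideals lie in the coradical *)

Section Socle.
Variables (K : fieldType) (E : coalgType K).
Implicit Types (f g h : {scalar E}) (e : E) (W S : E -> Prop).

Definition simple_lsub S :=
  [/\ subspace S, lstable S, exists2 s, S s & s != 0
    & forall W, subspace W -> lstable W -> (forall x, W x -> S x) ->
      (forall x, W x -> x = 0) \/ (forall x, S x -> W x)].

(** [hitr f] commutes with all [hitl h], so it is a comodule map: elements of the coefficient
    coalgebra lie in finite sums of images of [S], and one inducts on the number of summands. *)
Fixpoint hit_sum S (l : seq {scalar E}) : E -> Prop :=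
  if l is f :: l' then fun x => exists s t, [/\ S s, hit_sum S l' t & x = hitr f s + t]
  else fun x => x = 0.

Lemma hit_sum_subspace S l : subspace S -> subspace (hit_sum S l).
Proof.
move=> [S0 SL]; elim: l => [|f l [T0 TL]] /=.
  by split=> // a x y -> ->; rewrite scaler0 addr0.
split=> [|a _ _ [s [t [Ss Tt ->]]] [s' [t' [Ss' Tt' ->]]]].
  by exists 0, 0; split=> //; rewrite linear0 addr0.
exists (a *: s + s'), (a *: t + t'); split; [exact: SL|exact: TL|].
by rewrite linearP scalerDr addrACA.
Qed.

Lemma hit_sum_lstable S l : lstable S -> lstable (hit_sum S l).
Proof.
move=> lS; elim: l => [|f l IH] h e /=; first by move=> ->; rewrite linear0.
move=> [s [t [Ss Tt ->]]]; exists (hitl h s), (hitl h t).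
by split; [exact: lS|exact: IH|rewrite linearD/= hitlC].
Qed.

Lemma hit_sum_cat S l l' x y :
  hit_sum S l x -> hit_sum S l' y -> hit_sum S (l ++ l') (x + y).
Proof.
elim: l x => [|f l IH] x /=; first by move=> ->; rewrite add0r.
move=> [s [t [Ss Tt ->]]] Ty; exists s, (t + y); split=> //; first exact: IH.
by rewrite addrA.
Qed.

Section SimpleCoalgebra.
Variable S : E -> Prop.
Hypothesis simS : simple_lsub S.

(** The coefficient coalgebra of [S], spanned by the f(s_1) s_2; taking [counit] for [f] shows that
    it contains [S]. *)
Definition hit_span : {pred E} := lspan [set x | exists f s, S s /\ x = hitr f s].
Local Notation D := hit_span.

Let sS : subspace S. Proof. by case: simS. Qed.
Let lS : lstable S. Proof. by case: simS. Qed.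

Let D_subspace : subspace (fun x => x \in D). Proof. exact: subspace_lspan. Qed.

Let D_hitr f s : S s -> hitr f s \in D.
Proof. by move=> Ss; apply: sub_lspan; exists f, s. Qed.

Let D_subcoalgebra : subcoalgebra D.
Proof.
apply: stable_subcoalgebra => // h e De.
- apply: (lspan_subspace (subspace_preim (hitl h) D_subspace) _ De) => _ [f [s [Ss ->]]].
  by rewrite /= hitlC; apply: D_hitr; exact: lS.
- apply: (lspan_subspace (subspace_preim (hitr h) D_subspace) _ De) => _ [f [s [Ss ->]]].
  by rewrite /= hitr_hitr; exact: D_hitr.
Qed.

Let D_hit_sum x : x \in D -> exists l, hit_sum S l x.
Proof.
apply: (@lspan_subspace _ _ _ (fun x => exists l, hit_sum S l x)); last first.
  move=> _ [f [s [Ss ->]]]; exists [:: f], s, 0 => /=.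
  by split=> //; rewrite addr0.
split=> [|a y z [l Ty] [l' Tz]]; first by exists [::].
by exists (l ++ l'); apply: hit_sum_cat => //; apply: subspaceZ => //; exact: hit_sum_subspace.
Qed.

Section Minimality.
Variable D' : {pred E}.
Hypotheses (subD' : subcoalgebra D') (D'D : {subset D' <= D}).

Let ann f := forall x, x \in D' -> f x = 0.

(** A right coideal inside [S], hence 0 or [S] by simplicity. These cases will give that [D']
    contains [D], respectively that [D'] is 0. *)
Let hitl_ann_span : {pred E} := lspan [set x | exists f s, [/\ ann f, S s & x = hitl f s]].

Let D'_ind : (forall s, S s -> s \in hitl_ann_span) -> forall x, x \in D' -> x = 0.
Proof.
have [sD' lD' rD'] := subcoalgebra_stable subD'.
move=> SJ x D'x; have [l] := D_hit_sum (D'D D'x).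
elim: l x D'x => // f l IH x D'x [s [t [Ss Tt xE]]].
have sT := hit_sum_subspace l sS; have lT := hit_sum_lstable (l := l) lS.
(* The possible leading terms [s] of elements of [D']. By simplicity, either only 0 occurs, and the
   summand drops out, or all of [S] occurs. *)
pose S1 s := S s /\ exists2 t, hit_sum S l t & hitr f s + t \in D'.
have sS1 : subspace S1.
  split=> [|a u v [Su [t1 T1 D1]] [Sv [t2 T2 D2]]].
    by split; [case: sS|exists 0; [case: sT|rewrite linear0 addr0; case: sD']].
  split; first by case: sS => _; apply.
  exists (a *: t1 + t2); first by case: sT => _; apply.
  by rewrite linearP addrACA -scalerDr; case: sD' => _; apply.
have lS1 : lstable S1.
  move=> h u [Su [t1 T1 D1]]; split; first exact: lS.
  by exists (hitl h t1); [exact: lT|rewrite -hitlC -linearD/=; exact: lD'].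
case: simS => _ _ _ /(_ S1 sS1 lS1 (fun x => @proj1 _ _))[S10|SS1].
  have s0 : s = 0 by apply: S10; split=> //; exists t; rewrite -?xE.
  by apply: IH => //; rewrite xE s0 linear0 add0r.
(* Applying [hitl g], with [g] zero on [D'], to hitr f u + t1 in [D'] gives 0; so [hitr f] sends
   each generator [hitl g u] of [S] into the shorter sum. *)
apply: IH => //; rewrite xE; apply: subspaceD => //.
apply: (lspan_subspace (subspace_preim (hitr f) sT) _ (SJ s Ss)) => _ [g [u [gD' Su ->]]].
have [_ [t1 T1 D1]] := SS1 u Su.
rewrite /= -hitlC; have := hitl_ann rD' gD' D1; rewrite linearD/= => /eqP.
rewrite addr_eq0 => /eqP ->; rewrite -scaleN1r; apply: subspaceZ => //; exact: lT.
Qed.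

Lemma hit_span_minimal : (forall x, x \in D' -> x = 0) \/ {subset D <= D'}.
Proof.
have [sD' lD' rD'] := subcoalgebra_stable subD'.
pose J x := x \in hitl_ann_span.
have sJ : subspace J by exact: subspace_lspan.
have lJ : lstable J.
  move=> h x; apply: (lspan_subspace (subspace_preim (hitl h) sJ)) => _ [f [s [fD' Ss ->]]].
  rewrite /= hitl_hitl; apply: sub_lspan; exists (h \o hitl f), s; split=> // y D'y /=.
  by rewrite (hitl_ann (h := f) rD')// linear0.
have JS x : J x -> S x.
  by apply: lspan_subspace => // _ [f [s [_ Ss ->]]]; exact: lS.
case: simS => _ _ _ /(_ J sJ lJ JS)[J0|SJ]; [right|by left; exact: D'_ind].
move=> x; apply: (@lspan_subspace _ _ _ (fun x => x \in D')) => // _ [f [s [Ss ->]]].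
(* A form [g] zero on [D'] detecting [hitr f s] would give 1 = g (hitr f s) = f (hitl g s), but
   [hitl g s] lies in the span assumed to be 0. *)
apply: contrapT => nD'; have [g gD' g1] := separating_form sD' nD'.
have gs0 : hitl g s = 0 by apply: J0; apply: sub_lspan; exists g, s.
by move/eqP: g1; rewrite -hitlr gs0 linear0 eq_sym oner_eq0.
Qed.
End Minimality.

Lemma simple_lsub_corad s : S s -> s \in corad E.
Proof.
move=> Ss; apply: sub_lspan; exists D; last by rewrite -[s]hitr_counit; exact: D_hitr.
split=> //; last exact: hit_span_minimal.
by case: simS => _ _ [u Su u0] _; exists u => //; rewrite -[u]hitr_counit; exact: D_hitr.
Qed.
End SimpleCoalgebra.
End Socle.

(** * The filtration by iterated wedges *)

Section Filtration.
Variables (K : fieldType) (C E : coalgType K) (i : {linear C -> E}).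
Hypothesis hom_i : coalgebra_hom i.
Implicit Types (f h : {scalar E}) (e : E).

(** The wedge, tested by forms: [coprod e] lies in F_n \ot E + E \ot F_0 exactly when every form
    vanishing on F_0, applied to the right leg, leaves an element of F_n. *)
Fixpoint filtration n : E -> Prop :=
  if n is n'.+1 then
    fun e => forall f, (forall c, f (i c) = 0) -> filtration n' (hitl f e)
  else fun e => exists c, e = i c.

Lemma hitl_hom f c : hitl f (i c) = tsum (coprod c) (fun a b => f (i b) *: i a).
Proof. by rewrite hitlE (tsum_coalgebra_hom _ hom_i)//; lin. Qed.

Lemma hitl_hom0 f c : (forall c, f (i c) = 0) -> hitl f (i c) = 0.
Proof.
move=> fi0; rewrite hitl_hom -[RHS](tsum0 _ (coprod c)); apply: eq_tsum => a b.
by rewrite fi0 scale0r.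
Qed.

Lemma filtration_subspace n : subspace (filtration n).
Proof.
elim: n => [|n [F0 FL]] /=.
  split=> [|a _ _ [c ->] [d ->]]; first by exists 0; rewrite linear0.
  by exists (a *: c + d); rewrite linearP.
split=> [f fi0|a x y Fx Fy f fi0]; first by rewrite linear0.
by rewrite linearP; apply: FL; [exact: Fx|exact: Fy].
Qed.

(** Since F_0 is a right coideal, [f \o hitl h] vanishes on it whenever [f] does. *)
Lemma filtration_lstable n : lstable (filtration n).
Proof.
have l0 : lstable (filtration 0).
  move=> f _ [c ->]; rewrite hitl_hom.
  exists (tsum (coprod c) (fun a b => f (i b) *: a)).
  by rewrite lin_tsum; [apply: eq_tsum => a b; rewrite linearZ|exact: linearP].
case: n => // n h e Fe f fi0; rewrite hitl_hitl; apply: Fe => c /=.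
by have [d ->] := l0 h (i c) (ex_intro _ c erefl).
Qed.

Lemma filtrationS n e : filtration n e -> filtration n.+1 e.
Proof.
elim: n e => [|n IH] e; last by move=> Fe f fi0; apply: IH; exact: Fe.
by move=> [c ->] f fi0; exists 0; rewrite linear0 hitl_hom0.
Qed.

Lemma filtration_le m n e : (m <= n)%N -> filtration m e -> filtration n e.
Proof.
move=> /subnK <-; elim: (n - m)%N => // k IH Fe.
by rewrite addSn; apply: filtrationS; exact: IH.
Qed.

Lemma filtration_span (s : seq E) : (forall x, x \in s -> exists n, filtration n x) ->
  exists n, forall x, span_seq s x -> filtration n x.
Proof.
move=> sF; suff [n nF] : exists n, forall x, x \in s -> filtration n x.
  by exists n; apply: span_seq_sub => //; exact: filtration_subspace.
elim: s sF => [|y s IH] sF; first by exists 0%N.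
have [|n nF] := IH; first by move=> x xs; apply: sF; rewrite inE xs orbT.
have [|m mF] := sF y; first by rewrite mem_head.
exists (maxn m n) => x; rewrite inE => /predU1P[->|xs].
  by apply: filtration_le mF; rewrite leq_maxl.
by apply: filtration_le (nF x xs); rewrite leq_maxr.
Qed.

Section Exhaustion.
Hypothesis corad_sub : forall e, e \in corad E -> exists c, i c = e.

(* When W / M is simple, [hitr xi] maps it onto a simple left-stable subspace of E,
   hence into the coradical. *)
Let hitr_simple (M W : E -> Prop) (xi : {scalar E}) :
  subspace W -> lstable W -> lstable M -> (forall x, M x -> xi x = 0) ->
  (forall x, M x -> W x) ->
  (forall W', subspace W' -> lstable W' -> (forall x, M x -> W' x) ->
     (forall x, W' x -> W x) -> (forall x, W' x -> M x) \/ (forall x, W x -> W' x)) ->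
  forall w, W w -> exists c, i c = hitr xi w.
Proof.
move=> sW lW lM xiM MW minW w Ww.
pose S x := exists2 v, W v & x = hitr xi v.
(* A zero value is set aside because the image [S] must be nonzero to be simple. *)
have [w0|w0] := eqVneq (hitr xi w) 0; first by exists 0; rewrite w0 linear0.
apply: corad_sub; apply: (@simple_lsub_corad _ _ S); last by exists w.
split; last 2 first.
- by exists (hitr xi w) => //; exists w.
- move=> T sT lT TS; pose W' x := W x /\ T (hitr xi x).
  have := minW W' _ _ _ (fun x => @proj1 _ _); case.
  + by apply: subspaceI => //; exact: (subspace_preim (hitr xi)).
  + by move=> h x [Wx Tx]; split; [exact: lW|rewrite -hitlC; exact: lT].
  + move=> x Mx; split; first exact: MW.
    by rewrite (hitr_ann lM xiM Mx); case: sT.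
  + move=> W'M; left => x Tx; have [v Wv xE] := TS x Tx.
    by rewrite xE; apply: (hitr_ann lM xiM); apply: W'M; split; rewrite -?xE.
  + by move=> WW'; right => _ [v Wv ->]; case: (WW' v Wv).
- case: sW => W0 WL; split=> [|a _ _ [u Wu ->] [v Wv ->]].
    by exists 0; rewrite ?linear0.
  by exists (a *: u + v); [exact: WL|rewrite linearP].
- by move=> h _ [v Wv ->]; exists (hitl h v); [exact: lW|rewrite hitlC].
Qed.

(** Inside the finite-dimensional coideal generated by [e], a simple step above the part already
    exhausted lies in the next layer, since its coefficients are coradical. *)
Lemma filtration_exhaustive e : exists n, filtration n e.
Proof.
apply: contrapT => nFe.
pose V x := exists h, x = hitl h e.
have sV : subspace V.
  split=> [|a _ _ [f ->] [h ->]].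
    have z : scalar (fun _ : E => 0 : K) by move=> a x y; rewrite mulr0 addr0.
    exists (scalar_of z); rewrite hitlE -[LHS](tsum0 _ (coprod e)).
    by apply: eq_tsum => a b; rewrite scale0r.
  have z : scalar (fun x : E => a * f x + h x).
    move=> b x y; rewrite !linearP/= !mulrDr addrACA; congr (_ + _ + _).
    by rewrite mulrCA.
  exists (scalar_of z); rewrite !hitlE /tsum scaler_sumr -big_split/=.
  by apply: eq_bigr => p _; rewrite scalerDl scalerA.
have lV : lstable V by move=> h _ [f ->]; exists (h \o hitl f); exact: hitl_hitl.
(* Finiteness theorem: the left legs of one decomposition of [coprod e] span [V]. *)
have [s Vs] : exists s, forall x, V x -> span_seq s x.
  exists [seq p.1 | p <- tdec (coprod e)] => _ [h ->]; rewrite hitlE.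
  rewrite /tsum big_seq_cond; elim/big_rec: _ => [|p x]; first exact: subspace0 (span_seq_subspace _).
  rewrite andbT => pd; apply: subspaceD; first exact: span_seq_subspace.
  by apply: subspaceZ; [exact: span_seq_subspace|exact/span_seq_mem/map_f].
pose Finf x := exists n, filtration n x.
have sFinf : subspace Finf.
  split=> [|a x y [n Fx] [m Fy]]; first by exists 0%N; case: (filtration_subspace 0).
  exists (maxn n m); case: (filtration_subspace (maxn n m)) => _; apply.
    by apply: filtration_le Fx; rewrite leq_maxl.
  by apply: filtration_le Fy; rewrite leq_maxr.
pose M x := V x /\ Finf x.
have sM : subspace M by exact: subspaceI.
have lM : lstable M.
  by move=> h x [Vx [n Fx]]; split; [exact: lV|exists n; exact: filtration_lstable].
have [n MF] : exists n, forall x, M x -> filtration n x.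
  have [s' _ Ms'] := span_seq_subspaceP sM (fun x Mx => Vs x (proj1 Mx)).
  have [|n nF] := @filtration_span s'; last by exists n => x /Ms'/nF.
  by move=> x /span_seq_mem/Ms'[].
pose cand (W : E -> Prop) m := [/\ subspace W, lstable W, (forall x, M x -> W x),
  (forall x, W x -> V x)
  & (exists2 x, W x & ~ M x) /\ exists2 s, (size s <= m)%N & forall x, W x <-> span_seq s x].
(* [V] itself is a candidate, because it contains [e]. A candidate with fewest generators has no
   right coideal strictly between it and [M]. *)
have exm : exists m, `[< exists W, cand W m >].
  have [s' _ Vs'] := span_seq_subspaceP sV Vs.
  exists (size s'); apply/asboolP; exists V; split=> //; first by move=> x [].
  split; last by exists s'.
  by exists e; [exists counit; rewrite hitl_counit|case=> _; exact: nFe].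
case: (ex_minnP exm) => m /asboolP[W [sW lW MW WV [[w Ww nMw] [s' ss' Ws']]]] m_min.
case: (nMw); split; first exact: WV.
(* If [hitl f w] were outside [M], a form [xi] zero on [M] would take the value 1 there; but xi
   (hitl f w) = f (hitr xi w), and [hitr xi w] lies in the image of [i], where [f] vanishes. *)
exists n.+1 => f fi0; apply: MF; apply: contrapT => nMfw.
have [xi xiM] := separating_form sM nMfw.
suff [c cE] : exists c, i c = hitr xi w by rewrite hitlr -cE fi0 => /eqP; rewrite eq_sym oner_eq0.
apply: hitr_simple sW lW lM xiM MW _ _ Ww => W' sW' lW' MW' W'W.
have [W'M|nW'M] := pselect (forall x, W' x -> M x); [by left|right=> x Wx].
apply: contrapT => nW'x.
have [y W'y nMy] : exists2 y, W' y & ~ M y.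
  apply: contrapT => nM; apply: nW'M => y W'y; apply: contrapT => nMy.
  by apply: nM; exists y.
have [||s'' ss'' Ws''] := @span_seq_proper _ _ s' W' sW'.
- by move=> z /W'W/Ws'.
- by exists x => //; apply/Ws'.
suff /m_min : `[< exists W, cand W (size s'') >].
  by rewrite leqNgt (leq_trans ss'' ss').
apply/asboolP; exists W'; split=> //; first by move=> z /W'W/WV.
by split; [exists y|exists s''].
Qed.
End Exhaustion.
End Filtration.

(** * Formal smoothness *)

Lemma tassoc_tsum (K : fieldType) (U V W : lmodType K) (y : U \ox V) (w : W) :
  tassoc (y \ot w) = tsum y (fun u v => u \ot (v \ot w)).
Proof.
rewrite -[y in LHS]tsum_tpure (lin_tsum _ _ (f := fun y => tassoc (y \ot w))); last by lin.
by apply: eq_tsum => u v; exact: tassocE.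
Qed.

Lemma tassocV_tsum (K : fieldType) (U V W : lmodType K) (u : U) (y : V \ox W) :
  tassocV (u \ot y) = tsum y (fun v w => (u \ot v) \ot w).
Proof.
rewrite -[y in LHS]tsum_tpure (lin_tsum _ _ (f := fun y => tassocV (u \ot y))); last by lin.
by apply: eq_tsum => v w; exact: tassocVE.
Qed.

Section FreeBicomodule.
Variables (K : fieldType) (C : coalgType K) (Z : lmodType K).
Variable r : {linear Z -> Z \ox C}.
Hypothesis rA : forall z, tassoc (tmap r idfun (r z)) = tmap idfun coprod (r z).
Hypothesis r1 : forall z, tformr counit (r z) = z.

(** C \ox Z is the cofree left comodule on the space [Z]; the coaction [r] of [Z] supplies the right
    structure. *)
Definition free_lcoact (x : C \ox Z) : C \ox (C \ox Z) := tassoc (tmap coprod idfun x).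
Definition free_rcoact (x : C \ox Z) : (C \ox Z) \ox C := tassocV (tmap idfun r x).

Fact free_lcoact_is_linear : linear free_lcoact.
Proof. exact: (linearP (tassoc \o tmap coprod idfun)). Qed.
HB.instance Definition _ :=
  GRing.isLinear.Build K (C \ox Z) (C \ox (C \ox Z)) *:%R free_lcoact free_lcoact_is_linear.

Fact free_rcoact_is_linear : linear free_rcoact.
Proof. exact: (linearP (tassocV \o tmap idfun r)). Qed.
HB.instance Definition _ :=
  GRing.isLinear.Build K (C \ox Z) ((C \ox Z) \ox C) *:%R free_rcoact free_rcoact_is_linear.

Lemma free_lcoactE a z :
  free_lcoact (a \ot z) = tsum (coprod a) (fun a1 a2 => a1 \ot (a2 \ot z)).
Proof. by rewrite /free_lcoact tmapE tassoc_tsum. Qed.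

Lemma free_rcoactE a z :
  free_rcoact (a \ot z) = tsum (r z) (fun z0 z1 => (a \ot z0) \ot z1).
Proof. by rewrite /free_rcoact tmapE tassocV_tsum. Qed.

Fact free_lcoactA x :
  tassoc (tmap coprod idfun (free_lcoact x)) = tmap idfun free_lcoact (free_lcoact x).
Proof.
move: x; apply: (tensor_ext (f := tassoc \o (tmap coprod idfun \o free_lcoact))
                            (g := tmap idfun free_lcoact \o free_lcoact)) => a z.
rewrite [LHS]/= [RHS]/=  free_lcoactE.
rewrite !lin_tsum; [|exact: linearP..].
transitivity (tsum (coprod a) (fun x b => tsum (coprod x) (fun a1 a2 =>
  a1 \ot (a2 \ot (b \ot z))))).
  by apply: eq_tsum => x b; rewrite tmapE tassoc_tsum.
rewrite coprod_assoc; last by trilin.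
apply: eq_tsum => a1 x; rewrite tmapE/= free_lcoactE.
by rewrite lin_tsum; last by lin.
Qed.

Fact free_lcoact1 x : tforml counit (free_lcoact x) = x.
Proof.
move: x; apply: (tensor_ext (f := tforml counit \o free_lcoact) (g := idfun)) => a z.
rewrite [LHS]/=  free_lcoactE lin_tsum; last exact: linearP.
transitivity (tsum (coprod a) (fun a1 a2 => counit a1 *: (a2 \ot z))).
  by apply: eq_tsum => a1 a2; rewrite tformlE.
by rewrite (coprod_counitl _ (f := fun x => x \ot z))//; lin.
Qed.

Let free_rcoact_pure a z : free_rcoact (a \ot z) = tmap (tpure a) idfun (r z).
Proof. by rewrite free_rcoactE tmapE_tsum. Qed.

Fact free_rcoactA x :
  tassoc (tmap free_rcoact idfun (free_rcoact x)) = tmap idfun coprod (free_rcoact x).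
Proof.
move: x; apply: (tensor_ext (f := tassoc \o (tmap free_rcoact idfun \o free_rcoact))
                            (g := tmap idfun coprod \o free_rcoact)) => a z.
rewrite [LHS]/= [RHS]/=  free_rcoact_pure.
transitivity (tassoc (tmap (tmap (tpure a) idfun) idfun (tmap r idfun (r z)))).
  by congr tassoc; apply: tmap_comp_eq => //= v; rewrite -free_rcoact_pure.
rewrite tassoc_nat rA; apply: tmap_comp_eq => //= v.
by rewrite tmap_id.
Qed.

Fact free_rcoact1 x : tformr counit (free_rcoact x) = x.
Proof.
move: x; apply: (tensor_ext (f := tformr counit \o free_rcoact) (g := idfun)) => a z.
by rewrite [LHS]/=  free_rcoact_pure tformr_nat r1.
Qed.

Fact free_lrcoact x :
  tassoc (tmap free_lcoact idfun (free_rcoact x))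
    = tmap idfun free_rcoact (free_lcoact x).
Proof.
move: x; apply: (tensor_ext (f := tassoc \o (tmap free_lcoact idfun \o free_rcoact))
                            (g := tmap idfun free_rcoact \o free_lcoact)) => a z.
rewrite [LHS]/= [RHS]/=.
rewrite free_lcoactE free_rcoactE !lin_tsum; [|exact: linearP..].
transitivity (tsum (r z) (fun z0 z1 => tsum (coprod a) (fun a1 a2 =>
   a1 \ot ((a2 \ot z0) \ot z1)))).
  apply: eq_tsum => z0 z1; rewrite tmapE/= free_lcoactE.
  rewrite (lin_tsum _ _ (f := fun y => tassoc (y \ot z1))); last by lin.
  by apply: eq_tsum => a1 a2; rewrite tassocE.
rewrite exchange_tsum; apply: eq_tsum => a1 a2.
rewrite tmapE/= free_rcoactE lin_tsum//; lin.
Qed.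

Definition free_bicomodule : bicomodule C :=
  Bicomodule free_lcoactA free_lcoact1 free_rcoactA free_rcoact1 free_lrcoact.
End FreeBicomodule.

Section Coderivation.
Variables (K : fieldType) (C : coalgType K).
Local Notation coprod := (@coprod K C).

Let Y : bicomodule C :=
  free_bicomodule (@cofree_rcoactA K C) (@cofree_rcoact1 K C).

Lemma cofree_lcoact_tsum (a b : C) :
  cofree_lcoact C (a \ot b) = tsum (coprod a) (fun a1 a2 => a1 \ot (a2 \ot b)).
Proof. by rewrite cofree_lcoactE tmapE_tsum. Qed.

Lemma cofree_rcoact_tsum (a b : C) :
  cofree_rcoact C (a \ot b) = tsum (coprod b) (fun b1 b2 => (a \ot b1) \ot b2).
Proof. by rewrite cofree_rcoactE tmapE_tsum. Qed.

(** The cobar differential that follows [coprod]. Coassociativity makes it vanish on coproducts, so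
    it descends to the cokernel. *)
Definition cobar (z : C \ox C) : C \ox (C \ox C) := cofree_lcoact C z - tmap idfun coprod z.

Fact cobar_is_linear : linear cobar.
Proof. exact: (linearP (cofree_lcoact C \- tmap idfun coprod)). Qed.
HB.instance Definition _ :=
  GRing.isLinear.Build K (C \ox C) (C \ox (C \ox C)) *:%R cobar cobar_is_linear.

Lemma cobar_pure a b : cobar (a \ot b) =
  tsum (coprod a) (fun a1 a2 => a1 \ot (a2 \ot b)) -
  tsum (coprod b) (fun b1 b2 => a \ot (b1 \ot b2)).
Proof.
rewrite /cobar cofree_lcoact_tsum tmapE/=; congr (_ - _).
by rewrite -[coprod b in LHS]tsum_tpure lin_tsum; last by lin.
Qed.

Let cobar_coprod z : range coprod z -> cobar z = 0.
Proof. by case=> c _ <-; rewrite /cobar /= coprodA subrr. Qed.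

Definition coker_cobar : coker_space C -> C \ox (C \ox C) := lquot_lift cobar.

Fact coker_cobar_is_linear : linear coker_cobar.
Proof. exact: lquot_lift_is_linear cobar_coprod. Qed.
HB.instance Definition _ :=
  GRing.isLinear.Build K (coker_space C) (C \ox (C \ox C)) *:%R coker_cobar
    coker_cobar_is_linear.

Lemma coker_cobarE z : coker_cobar (coker_proj C z) = cobar z.
Proof. exact: lquot_liftE cobar_coprod. Qed.

Let cobar_lcoact z :
  free_lcoact (cobar z) = tmap idfun cobar (cofree_lcoact C z).
Proof.
move: z; apply: (tensor_ext (f := free_lcoact (Z := C \ox C) \o cobar)
                            (g := tmap idfun cobar \o cofree_lcoact C)) => a b.
rewrite -[LHS]/(free_lcoact (cobar (a \ot b)))
  -[RHS]/(tmap idfun cobar (cofree_lcoact C (a \ot b))) cobar_pure cofree_lcoact_tsum linearB/=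
  !(lin_tsum _ _ (f := @free_lcoact K C (C \ox C))) ?(lin_tsum _ _ (f := tmap idfun cobar));
  [|exact: linearP..].
transitivity (tsum (coprod a) (fun a1 x => tsum (coprod x) (fun a2 a3 => a1 \ot (a2 \ot (a3 \ot b)))
  - tsum (coprod b) (fun b1 b2 => a1 \ot (x \ot (b1 \ot b2)))))%R; last first.
  apply: eq_tsum => a1 x; rewrite tmapE/= cobar_pure linearB/=.
  by congr (_ - _); rewrite lin_tsum//; lin.
rewrite tsumB -coprod_assoc; last by trilin.
congr (_ - _); first by apply: eq_tsum => x y; rewrite free_lcoactE.
rewrite exchange_tsum; apply: eq_tsum => b1 b2; by rewrite free_lcoactE.
Qed.

Let cobar_rcoact z :
  free_rcoact (cofree_rcoact C) (cobar z) = tmap cobar idfun (cofree_rcoact C z).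
Proof.
move: z; apply: (tensor_ext (f := free_rcoact (cofree_rcoact C) \o cobar)
                            (g := tmap cobar idfun \o cofree_rcoact C)) => a b.
rewrite -[LHS]/(free_rcoact (cofree_rcoact C) (cobar (a \ot b)))
  -[RHS]/(tmap cobar idfun (cofree_rcoact C (a \ot b))) cobar_pure cofree_rcoact_tsum linearB/=
  !(lin_tsum _ _ (f := free_rcoact (cofree_rcoact C))) ?(lin_tsum _ _ (f := tmap cobar idfun));
  [|exact: linearP..].
have E x y z : free_rcoact (cofree_rcoact C) (x \ot (y \ot z)) =
    tsum (coprod z) (fun z1 z2 => (x \ot (y \ot z1)) \ot z2).
  rewrite free_rcoactE cofree_rcoact_tsum.
  by rewrite (lin_tsum _ _ (f := fun t => tsum t (fun z0 z1 => (x \ot z0) \ot z1)));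
    [apply: eq_tsum => u v; rewrite tsum_pure//; lin|lin].
transitivity (tsum (coprod b) (fun x b3 => tsum (coprod a) (fun a1 a2 => (a1 \ot (a2 \ot x)) \ot b3)
  - tsum (coprod x) (fun b1 b2 => (a \ot (b1 \ot b2)) \ot b3)))%R; last first.
  apply: eq_tsum => x b3; rewrite tmapE/= cobar_pure linearBl/= ?/applyr.
  by congr (_ - _); rewrite (lin_tsum _ _ (f := fun t => t \ot b3))//; lin.
rewrite tsumB coprod_assoc; last by trilin.
congr (_ - _); last by apply: eq_tsum => x y; rewrite E.
rewrite exchange_tsum; apply: eq_tsum => b1 b2; by rewrite E.
Qed.

Let coker_cobar_hom : @bicomodule_hom K C (coker_coprod C) Y coker_cobar.
Proof.
split=> q; rewrite -[q]lreprK; set z := lrepr q; rewrite [LHS]/= [RHS]/= coker_cobarE.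
  rewrite coker_lcoactE tmap_comp cobar_lcoact; apply: eq_tmap => // x.
  exact/esym/coker_cobarE.
rewrite coker_rcoactE tmap_comp cobar_rcoact; apply: eq_tmap => // x.
exact/esym/coker_cobarE.
Qed.

(** The contracting homotopy of the cobar complex: counit \ot id sends [cobar z] to [z] minus a
    coproduct. It is only a linear retraction, which is all that relative injectivity asks for. *)
Let coker_cobar_retract : exists r : {linear Y -> coker_coprod C}, cancel coker_cobar r.
Proof.
exists (coker_proj C \o tforml counit) => q; rewrite -[q]lreprK; set z := lrepr q.
rewrite [LHS]/= coker_cobarE /cobar linearB/= cofree_lcoact1 tforml_nat linearB/=.
rewrite -[RHS]subr0; congr (_ - _); apply/eqP.
by rewrite lproj_eq0 sub_lspan//; exists (tforml counit z).
Qed.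

Let eps_diff (z : C \ox C) : C := tformr counit z - tforml counit z.

Fact eps_diff_is_linear : linear eps_diff.
Proof. exact: (linearP (tformr counit \- tforml counit)). Qed.
HB.instance Definition _ :=
  GRing.isLinear.Build K (C \ox C) C *:%R eps_diff eps_diff_is_linear.

Let eps_diff_coprod z : range coprod z -> eps_diff z = 0.
Proof. by case=> c _ <-; rewrite /eps_diff counitl counitr subrr. Qed.

Let delta : coker_space C -> C := lquot_lift eps_diff.

Fact delta_is_linear : linear delta.
Proof. exact: lquot_lift_is_linear eps_diff_coprod. Qed.
HB.instance Definition _ :=
  GRing.isLinear.Build K (coker_space C) C *:%R delta delta_is_linear.

Let deltaE z : delta (coker_proj C z) = eps_diff z.
Proof. exact: lquot_liftE eps_diff_coprod. Qed.

Let eps_diff_coderivation z : coprod (eps_diff z) =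
  tmap idfun eps_diff (cofree_lcoact C z) + tmap eps_diff idfun (cofree_rcoact C z).
Proof.
move: z; apply: (tensor_ext (f := coprod \o eps_diff)
  (g := (tmap idfun eps_diff \o cofree_lcoact C) \+ (tmap eps_diff idfun \o cofree_rcoact C))) => a b.
rewrite -[LHS]/(coprod (eps_diff (a \ot b)))
  -[RHS]/(tmap idfun eps_diff (cofree_lcoact C (a \ot b)) +
          tmap eps_diff idfun (cofree_rcoact C (a \ot b)))
  cofree_lcoact_tsum cofree_rcoact_tsum
  (lin_tsum _ _ (f := tmap idfun eps_diff)) ?(lin_tsum _ _ (f := tmap eps_diff idfun));
  [|exact: linearP..].
have E x y : eps_diff (x \ot y) = counit y *: x - counit x *: y.
  by rewrite /eps_diff tformlE tformrE.
transitivity (tsum (coprod a) (fun a1 a2 => counit b *: (a1 \ot a2) - counit a2 *: (a1 \ot b))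
   + tsum (coprod b) (fun b1 b2 => counit b1 *: (a \ot b2) - counit a *: (b1 \ot b2))); last first.
  congr (_ + _); apply: eq_tsum => x y; rewrite tmapE/= E.
    by rewrite linearBr !linearZr_LR.
  by rewrite linearBl !linearZl_LR.
rewrite !tsumB (coprod_counitr _ (f := fun x => x \ot b)); last by lin.
rewrite (coprod_counitl _ (f := fun x => a \ot x)); last by lin.
rewrite addrA subrK E linearB !linearZ/= -(lin_tsum _ _ (f := fun t => counit b *: t)); last by lin.
rewrite -(lin_tsum _ _ (f := fun t => counit a *: t)) ?tsum_tpure ?scalerN//; lin.
Qed.

Let delta_coderivation q : coprod (delta q) =
  tmap idfun delta (coker_lcoact q) + tmap delta idfun (coker_rcoact q).
Proof.
rewrite -[q]lreprK; set z := lrepr q.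
rewrite deltaE coker_lcoactE coker_rcoactE eps_diff_coderivation !tmap_comp.
by congr (_ + _); apply: eq_tmap => // x; apply/esym/deltaE.
Qed.

(* The retraction of the cobar differential provided by smoothness, followed by
   [a \ot b] |-> counit b *: a - counit a *: b. *)
Lemma formally_smooth_coderivation : formally_smooth C ->
  exists D : {linear C \ox (C \ox C) -> C},
    (forall a b, tsum (coprod a) (fun a1 a2 => D (a1 \ot (a2 \ot b))) -
       tsum (coprod b) (fun b1 b2 => D (a \ot (b1 \ot b2))) = counit b *: a - counit a *: b) /\
    (forall a b c, coprod (D (a \ot (b \ot c))) =
       tsum (coprod a) (fun a1 a2 => a1 \ot D (a2 \ot (b \ot c))) +
       tsum (coprod c) (fun c1 c2 => D (a \ot (b \ot c1)) \ot c2)).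
Proof.
move=> /(_ _ _ _ coker_cobar_hom coker_cobar_retract idfun).
case=> [|h [hl hr] hK]; first by split=> x /=; rewrite tmap_id.
exists (delta \o h); split=> [a b|a b c] /=.
  rewrite -(lin_tsum _ _ (f := delta \o h)); last exact: linearP.
  rewrite -[X in _ - X](lin_tsum _ _ (f := delta \o h)); last exact: linearP.
  rewrite -linearB -cobar_pure/= -coker_cobarE hK/= deltaE /eps_diff.
  by rewrite tformlE tformrE.
rewrite delta_coderivation.
have -> : coker_lcoact (h (a \ot (b \ot c))) = tmap idfun h (free_lcoact (a \ot (b \ot c))).
  exact: hl.
have -> : coker_rcoact (h (a \ot (b \ot c)))
        = tmap h idfun (free_rcoact (cofree_rcoact C) (a \ot (b \ot c))).
  exact: hr.
rewrite !tmap_comp free_lcoactE free_rcoactE cofree_rcoact_tsum; congr (_ + _).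
  by rewrite lin_tsum; [apply: eq_tsum => a1 a2; rewrite tmapE|exact: linearP].
rewrite lin_tsum; last exact: linearP.
rewrite (lin_tsum _ _ (f := fun t => tsum t _)).
  by apply: eq_tsum => c1 c2; rewrite tsum_pure ?tmapE//; lin.
by apply: lin_tsuml; lin.
Qed.
End Coderivation.

(** * Curvature of a linear map between coalgebras *)

Section Curvature.
Variables (K : fieldType) (C E : coalgType K).

Lemma tsum_lin0 (V W U : lmodType K) (F : V -> W -> U) : bilin F -> tsum 0 F = 0.
Proof. by move=> Fb; rewrite tsumE//; exact: (linear0 (linear_of (tlift_linear (bilinW Fb)))). Qed.

Lemma tsum_sub (V W U : lmodType K) (y z : V \ox W) (F : V -> W -> U) : bilin F ->
  tsum (y - z) F = tsum y F - tsum z F.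
Proof. by move=> Fb; rewrite !tsumE//; exact: (linearB (linear_of (tlift_linear (bilinW Fb)))). Qed.

Section Rho.
Variable rho : {linear E -> C}.

Definition curv (e : E) : C \ox C := coprod (rho e) - tmap rho rho (coprod e).

Fact curv_is_linear : linear curv.
Proof. exact: (linearP ((coprod \o rho) \- (tmap rho rho \o coprod))). Qed.
HB.instance Definition _ := GRing.isLinear.Build K E (C \ox C) *:%R curv curv_is_linear.

Lemma tsum_curv (U : lmodType K) e (F : C -> C -> U) : bilin F ->
  tsum (curv e) F = tsum (coprod (rho e)) F - tsum (coprod e) (fun a b => F (rho a) (rho b)).
Proof. by move=> Fb; rewrite tsum_sub// tsum_tmap. Qed.

Lemma tsum_coprod_rho (U : lmodType K) e (F : C -> C -> U) : bilin F ->
  tsum (coprod (rho e)) F = tsum (coprod e) (fun a b => F (rho a) (rho b)) + tsum (curv e) F.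
Proof. by move=> Fb; rewrite tsum_curv// addrC subrK. Qed.

(** A Bianchi identity, exact to all orders: by coassociativity in [C] and in [E], the terms free of
    curvature cancel. *)
Lemma curv_cocycle (U : lmodType K) e (F : C -> C -> C -> U) : trilin F ->
  tsum (curv e) (fun x c => tsum (coprod x) (fun a b => F a b c)) =
  tsum (curv e) (fun a x => tsum (coprod x) (fun b c => F a b c))
  + tsum (coprod e) (fun e1 e2 => tsum (curv e2) (fun b c => F (rho e1) b c))
  - tsum (coprod e) (fun e1 e2 => tsum (curv e1) (fun a b => F a b (rho e2))).
Proof.
move=> Ft; have [F1 F2 F3] := Ft.
rewrite tsum_curv; last by lin.
rewrite [X in _ = X + _ - _]tsum_curv; last by lin.
have -> : tsum (coprod e) (fun e1 e2 => tsum (curv e2) (fun b c => F (rho e1) b c)) =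
    tsum (coprod e) (fun e1 e2 => tsum (coprod (rho e2)) (F (rho e1))) -
    tsum (coprod e) (fun e1 x => tsum (coprod x) (fun e2 e3 => F (rho e1) (rho e2) (rho e3))).
  by rewrite -tsumB; apply: eq_tsum => e1 e2; rewrite tsum_curv//; lin.
have -> : tsum (coprod e) (fun e1 e2 => tsum (curv e1) (fun a b => F a b (rho e2))) =
    tsum (coprod e) (fun e1 e2 => tsum (coprod (rho e1)) (fun a b => F a b (rho e2))) -
    tsum (coprod e) (fun x e3 => tsum (coprod x) (fun e1 e2 => F (rho e1) (rho e2) (rho e3))).
  by rewrite -tsumB; apply: eq_tsum => e1 e2; rewrite tsum_curv//; lin.
rewrite (coprod_assoc _ (F := fun a b c => F (rho a) (rho b) (rho c))); last by trilin.
rewrite coprod_assoc//.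
by rewrite addrA subrK opprB addrA subrK.
Qed.

Hypothesis counit_rho : forall e, counit (rho e) = counit e.

Lemma curv_counitr (U : lmodType K) e (f : C -> U) : lin f ->
  tsum (curv e) (fun a b => counit b *: f a) = 0.
Proof.
move=> fL; rewrite tsum_curv; last by lin.
rewrite coprod_counitr//.
have -> : tsum (coprod e) (fun a b => counit (rho b) *: f (rho a)) =
    tsum (coprod e) (fun a b => counit b *: f (rho a)).
  by apply: eq_tsum => a b; rewrite counit_rho.
by rewrite (coprod_counitr _ (f := fun x => f (rho x))) ?subrr//; lin.
Qed.

Variable D : {linear C \ox (C \ox C) -> C}.
Hypothesis D_cobar : forall a b,
  tsum (coprod a) (fun a1 a2 => D (a1 \ot (a2 \ot b))) -
  tsum (coprod b) (fun b1 b2 => D (a \ot (b1 \ot b2))) = counit b *: a - counit a *: b.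
Hypothesis D_coder : forall a b c, coprod (D (a \ot (b \ot c))) =
  tsum (coprod a) (fun a1 a2 => a1 \ot D (a2 \ot (b \ot c))) +
  tsum (coprod c) (fun c1 c2 => D (a \ot (b \ot c1)) \ot c2).

(** The map e |-> - D(curv(e_1) \ot rho(e_2)), the homotopy [D] applied to the cocycle [curv]. *)
Definition correction (e : E) : C := - D (tassoc (tmap curv rho (coprod e))).

Fact correction_is_linear : linear correction.
Proof. exact: (linearP (\- (D \o (tassoc \o (tmap curv rho \o coprod))))). Qed.
HB.instance Definition _ := GRing.isLinear.Build K E C *:%R correction correction_is_linear.

Lemma correctionE e : correction e =
  - tsum (coprod e) (fun e1 e2 => tsum (curv e1) (fun a b => D (a \ot (b \ot rho e2)))).
Proof.
rewrite /correction tmapE_tsum; congr (- _).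
rewrite (lin_tsum _ _ (f := fun z => D (tassoc z))); last by lin.
apply: eq_tsum => e1 e2 /=; rewrite -[curv e1 in LHS]tsum_tpure.
rewrite (lin_tsum _ _ (f := fun z => D (tassoc (z \ot rho e2)))); last by lin.
by apply: eq_tsum => a b; rewrite tassocE.
Qed.

(** Applying counit \ot id to the coderivation rule cancels D(a \ot b \ot c) on both sides; what
    remains is the second sum, and one more [counit] finishes. *)
Lemma counit_D x : counit (D x) = 0.
Proof.
have Dc a b c : tsum (coprod c) (fun c1 c2 => counit (D (a \ot (b \ot c1))) *: c2) = 0.
  have := counitl (D (a \ot (b \ot c))); rewrite D_coder linearD/=.
  rewrite !(lin_tsum _ _ (f := tforml counit)); [|exact: linearP..].
  have -> : tsum (coprod a) (fun v w => tforml counit (v \ot D (w \ot (b \ot c))))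
          = D (a \ot (b \ot c)).
    rewrite -(coprod_counitl a (f := fun x => D (x \ot (b \ot c)))); last by lin.
    by apply: eq_tsum => v w; rewrite tformlE.
  move=> /(canRL (addKr _)); rewrite addNr => <-.
  by apply: eq_tsum => v w; rewrite tformlE.
apply: (tensor_ext3r (f := (counit \o D : {linear _ -> K^o})) (g := \0)) => a b c /=.
have := congr1 counit (Dc a b c); rewrite linear0 => <-.
rewrite slin_tsum -[RHS]/(tsum (coprod c) (fun u v : C => counit (counit (D (a \ot (b \ot u))) *: v) : K^o)).
rewrite -(coprod_counitr c (f := (fun x => counit (D (a \ot (b \ot x))) : K^o))).
  by apply: eq_tsum => v w; rewrite linearZ/= mulrC.
by move=> k y z; rewrite !(linearPr, linearP).
Qed.

Lemma counit_correction e : counit (correction e) = 0.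
Proof. by rewrite /correction linearN/= counit_D oppr0. Qed.

(** This is the linearisation at [rho] of the condition that [rho] + [g] be comultiplicative. The
    hypothesis removes every term containing the curvature twice. *)
Lemma coprod_correction e : tmap curv curv (coprod e) = 0 ->
  coprod (correction e) =
  tmap rho correction (coprod e) + tmap correction rho (coprod e) - curv e.
Proof.
move=> e0.
have quad (U : lmodType K) (G : C -> C -> C -> C -> U) :
    (forall a b, bilin (G a b)) -> (forall c d, bilin (fun a b => G a b c d)) ->
    tsum (coprod e) (fun e1 e2 => tsum (curv e1) (fun a b => tsum (curv e2) (G a b))) = 0.
  move=> Gl Gr; have b a c : bilin (G a c) by [].
  have b1 c d : bilin (fun a b => G a b c d) by [].
  have B : bilin (fun x y => tsum x (fun a b => tsum y (G a b))).
    split=> v; last by apply: lin_tsumr => u w; apply: lin_tsuml.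
    apply: lin_tsuml => //; split=> u; apply: lin_tsumr => x y; first by case: (b1 x y).
    by case: (b1 x y).
  by rewrite -(tsum_tmap _ _ _ B) e0 tsum_lin0.
pose Dw a b c := D (a \ot (b \ot c)).
rewrite correctionE linearN/= (lin_tsum _ _ (f := coprod)); last exact: linearP.
have -> : tsum (coprod e) (fun e1 e2 => coprod (tsum (curv e1) (fun a b => Dw a b (rho e2)))) =
   tsum (coprod e) (fun e1 e2 => tsum (curv e1) (fun x b =>
     tsum (coprod x) (fun a1 a2 => a1 \ot Dw a2 b (rho e2))))
   + tsum (coprod e) (fun e1 e2 => tsum (curv e1) (fun a b =>
     tsum (coprod (rho e2)) (fun c1 c2 => Dw a b c1 \ot c2))).
  rewrite -tsumD; apply: eq_tsum => e1 e2.
  rewrite (lin_tsum _ _ (f := coprod)) -?tsumD; last exact: linearP.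
  by apply: eq_tsum => a b; rewrite D_coder.
(* In the right half of the coderivation rule, the coproduct of [rho e2] is replaced by [rho] on
   both legs of [coprod e2], at the cost of a quadratic term. *)
have -> : tsum (coprod e) (fun e1 e2 => tsum (curv e1) (fun a b =>
     tsum (coprod (rho e2)) (fun c1 c2 => Dw a b c1 \ot c2))) =
     - tmap correction rho (coprod e).
  transitivity (tsum (coprod e) (fun e1 x => tsum (coprod x) (fun e2 e3 =>
      tsum (curv e1) (fun a b => Dw a b (rho e2) \ot rho e3)))
     + tsum (coprod e) (fun e1 e2 => tsum (curv e1) (fun a b =>
          tsum (curv e2) (fun c1 c2 => Dw a b c1 \ot c2)))).
    rewrite -tsumD; apply: eq_tsum => e1 e2; rewrite [X in _ = X + _]exchange_tsum -tsumD.
    by apply: eq_tsum => a b; rewrite tsum_coprod_rho//; rewrite /Dw; lin.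
  rewrite quad ?addr0; try by [move=> ? ?; rewrite /Dw; lin].
  rewrite -coprod_assoc; last by rewrite /Dw; trilin.
  rewrite tmapE_tsum -tsumN; apply: eq_tsum => x e3 /=; rewrite correctionE linearNl opprK/= ?/applyr.
  rewrite (lin_tsum _ _ (f := fun t => t \ot rho e3)); last by lin.
  apply: eq_tsum => e1 e2; rewrite (lin_tsum _ _ (f := fun t => t \ot rho e3)) //; lin.
(* In the left half, the cocycle identity moves the coproduct from the first leg of the curvature to
   the second, where [D_cobar] can act. *)
have -> : tsum (coprod e) (fun e1 e2 => tsum (curv e1) (fun x b =>
     tsum (coprod x) (fun a1 a2 => a1 \ot Dw a2 b (rho e2)))) =
     curv e - tmap rho correction (coprod e).
  transitivity (tsum (coprod e) (fun e1 e2 => tsum (curv e1) (fun a x =>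
       tsum (coprod x) (fun b c => a \ot Dw b c (rho e2))))
    + tsum (coprod e) (fun x e3 => tsum (coprod x) (fun e1 e2 =>
       tsum (curv e2) (fun b c => rho e1 \ot Dw b c (rho e3))))
    - tsum (coprod e) (fun x e3 => tsum (coprod x) (fun e1 e2 =>
       tsum (curv e1) (fun a b => a \ot Dw b (rho e2) (rho e3))))).
    rewrite -tsumD -tsumB; apply: eq_tsum => e1 e2; apply: curv_cocycle.
    by rewrite /Dw; trilin.
  have -> : tsum (coprod e) (fun x e3 => tsum (coprod x) (fun e1 e2 =>
       tsum (curv e2) (fun b c => rho e1 \ot Dw b c (rho e3)))) =
       - tmap rho correction (coprod e).
    rewrite coprod_assoc; last by rewrite /Dw; trilin.
    rewrite tmapE_tsum -tsumN; apply: eq_tsum => e1 x /=.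
    rewrite correctionE linearNr opprK/=.
    rewrite (lin_tsum _ _ (f := fun t => rho e1 \ot t)); last by lin.
    apply: eq_tsum => e2 e3; rewrite (lin_tsum _ _ (f := fun t => rho e1 \ot t)) //; lin.
  suff -> : tsum (coprod e) (fun e1 e2 => tsum (curv e1) (fun a x =>
       tsum (coprod x) (fun b c => a \ot Dw b c (rho e2)))) =
     curv e + tsum (coprod e) (fun x e3 => tsum (coprod x) (fun e1 e2 =>
       tsum (curv e1) (fun a b => a \ot Dw b (rho e2) (rho e3)))).
    by rewrite addrAC addrK.
  (* [D_cobar] produces the term counit(e_2) curv(e_1), which sums to [curv e], and a term with
     [counit] on the second leg of the curvature, zero by [curv_counitr]. *)
  transitivity (tsum (coprod e) (fun e1 e2 => counit e2 *: curv e1)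
    + tsum (coprod e) (fun e1 e2 => tsum (curv e1) (fun a b =>
         tsum (coprod (rho e2)) (fun c1 c2 => a \ot Dw b c1 c2)))).
    rewrite -tsumD; apply: eq_tsum => e1 e2.
    transitivity (tsum (curv e1) (fun a b => counit e2 *: (a \ot b)
       - counit b *: (a \ot rho e2)
       + tsum (coprod (rho e2)) (fun c1 c2 => a \ot Dw b c1 c2))).
      apply: eq_tsum => a x.
      rewrite -(lin_tsum _ _ (f := fun t => a \ot t)); last by lin.
      rewrite -[X in _ = _ + X](lin_tsum _ _ (f := fun t => a \ot t)); last by lin.
      rewrite -counit_rho -!linearZr_LR -linearBr -linearDr; congr (_ \ot _).
      by rewrite -D_cobar subrK.
    rewrite tsumD tsumB (curv_counitr _ (f := fun a => a \ot rho e2)); last by lin.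
    rewrite subr0 -(lin_tsum _ _ (f := fun t => counit e2 *: t)) ?tsum_tpure//; lin.
  rewrite (coprod_counitr _ (f := curv)); last exact: linearP.
  congr (_ + _); rewrite coprod_assoc; last by rewrite /Dw; trilin.
  transitivity (tsum (coprod e) (fun e1 x => tsum (coprod x) (fun e2 e3 =>
       tsum (curv e1) (fun a b => a \ot Dw b (rho e2) (rho e3))))
     + tsum (coprod e) (fun e1 e2 => tsum (curv e1) (fun a b =>
         tsum (curv e2) (fun c1 c2 => a \ot Dw b c1 c2)))).
    rewrite -tsumD; apply: eq_tsum => e1 e2; rewrite [X in _ = X + _]exchange_tsum -tsumD.
    by apply: eq_tsum => a b; rewrite tsum_coprod_rho//; rewrite /Dw; lin.
  by rewrite quad ?addr0//; move=> ? ?; rewrite /Dw; lin.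
by rewrite opprD opprB opprK addrAC.
Qed.
End Rho.

(** A solution of the linearised equation leaves only the quadratic part of the curvature of the
    sum. *)
Lemma curv_add (rho g : {linear E -> C}) e :
  coprod (g e) = tmap rho g (coprod e) + tmap g rho (coprod e) - curv rho e ->
  curv (rho \+ g) e = - tmap g g (coprod e).
Proof.
move=> ge; rewrite /curv/= linearD/= ge /curv opprB.
have -> : tmap (fun x => rho x + g x) (fun x => rho x + g x) (coprod e) =
   tmap rho rho (coprod e) + tmap rho g (coprod e) + (tmap g rho (coprod e) + tmap g g (coprod e)).
  rewrite (tmapE_tsum (rho \+ g) (rho \+ g)) !tmapE_tsum -!tsumD; apply: eq_tsum => v w /=.
  by rewrite linearDl !linearDr.
set a := coprod _; set r := tmap rho rho _; set x := tmap rho g _; set y := tmap g rho _.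
rewrite addrCA [a + (r - a)]addrC subrK addrA -[r + x + y]addrA [r + _]addrC.
by rewrite opprD addrA subrr sub0r.
Qed.
End Curvature.

(** * Successive corrections and their limit *)

Section Lifting.
Variables (K : fieldType) (C E : coalgType K) (i : {linear C -> E}).
Hypothesis hom_i : coalgebra_hom i.
Local Notation F := (filtration i).

(** For a form [g] on [V], the form [g \o b] vanishes on F_0, so by the definition of the wedge it
    takes [e] into F_n, which [a] kills. *)
Lemma filtration_tmap0 (U V : lmodType K) (a : {linear E -> U}) (b : {linear E -> V}) n e :
  (forall x, F n x -> a x = 0) -> (forall c, b (i c) = 0) -> F n.+1 e ->
  tmap a b (coprod e) = 0.
Proof.
move=> aF bi Fe; apply: tformr_eq0 => g.
have -> : tmap a b (coprod e) = tmap idfun b (tmap a idfun (coprod e)) by rewrite tmap_comp.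
have -> : tformr g (tmap idfun b (tmap a idfun (coprod e)))
        = tformr (g \o b) (tmap a idfun (coprod e)).
  by rewrite tformr_tsum tsum_tmap; [rewrite tformr_tsum|lin].
by rewrite tformr_nat; apply/aF/Fe => c /=; rewrite bi linear0.
Qed.

Lemma filtration_tmap0l (U V : lmodType K) (a : {linear E -> U}) (b : {linear E -> V}) n e :
  (forall x, F n x -> a x = 0) -> F n e -> tmap a b (coprod e) = 0.
Proof.
move=> aF Fe; apply: tformr_eq0 => g.
have -> : tmap a b (coprod e) = tmap idfun b (tmap a idfun (coprod e)) by rewrite tmap_comp.
have -> : tformr g (tmap idfun b (tmap a idfun (coprod e)))
        = tformr (g \o b) (tmap a idfun (coprod e)).
  by rewrite tformr_tsum tsum_tmap; [rewrite tformr_tsum|lin].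
by rewrite tformr_nat; apply/aF/filtration_lstable.
Qed.

(** All three conditions are affine in [g]; this is what averaging will use. *)
Definition corrects n (rho g : {linear E -> C}) : Prop :=
  [/\ forall e, counit (g e) = 0, forall e, F n e -> g e = 0
    & forall e, F n.+1 e -> coprod (g e) =
        tmap rho g (coprod e) + tmap g rho (coprod e) - curv rho e].

Variable D : {linear C \ox (C \ox C) -> C}.
Hypothesis D_cobar : forall a b,
  tsum (coprod a) (fun a1 a2 => D (a1 \ot (a2 \ot b))) -
  tsum (coprod b) (fun b1 b2 => D (a \ot (b1 \ot b2))) = counit b *: a - counit a *: b.
Hypothesis D_coder : forall a b c, coprod (D (a \ot (b \ot c))) =
  tsum (coprod a) (fun a1 a2 => a1 \ot D (a2 \ot (b \ot c))) +
  tsum (coprod c) (fun c1 c2 => D (a \ot (b \ot c1)) \ot c2).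

Hypothesis exhaustive : forall e, exists n, F n e.

(** A class of maps closed under addition in which every solvable correction problem can be solved;
    later, equivariance for one or two actions. *)
Variable P : {linear E -> C} -> Prop.
Hypothesis P_add : forall r g, P r -> P g -> P (r \+ g).
Hypothesis P_corrects : forall n rho g, P rho -> corrects n rho g ->
  exists2 g', P g' & corrects n rho g'.

Definition hom_upto n (rho : {linear E -> C}) : Prop :=
  [/\ P rho, forall e, counit (rho e) = counit e, cancel i rho
    & forall e, F n e -> curv rho e = 0].

Lemma filtration_i n c : F n (i c).
Proof. by apply: (@filtration_le _ _ _ _ hom_i 0) => //; exists c. Qed.

(** The curvature and [g] both vanish on F_n, which contains F_0, so [filtration_tmap0] kills
    curvature \ot curvature and then g \ot g on F_(n+1). *)
Lemma hom_upto_step n rho : hom_upto n rho ->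
  exists2 rho', hom_upto n.+1 rho' & forall e, F n e -> rho' e = rho e.
Proof.
move=> [Pr cr ir Fr].
have [|g Pg [cg Fg Hg]] := @P_corrects n rho (correction rho D) Pr.
  split=> [e|e Fe|e Fe]; first exact: counit_correction.
    by rewrite /= /correction (filtration_tmap0l _ Fr Fe) !linear0.
  apply: coprod_correction => //; apply: (filtration_tmap0 Fr _ Fe) => c.
  exact/Fr/filtration_i.
exists (rho \+ g) => [|e Fe /=]; last by rewrite Fg ?addr0.
split=> [|e|c|e Fe] /=; first exact: P_add.
- by rewrite linearD/= cr cg addr0.
- by rewrite ir Fg ?addr0//; exact: filtration_i.
rewrite (curv_add (Hg e Fe)) (filtration_tmap0 Fg _ Fe) ?oppr0// => c.
exact/Fg/filtration_i.
Qed.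

Lemma hom_lift rho0 : hom_upto 0 rho0 ->
  exists p : {linear E -> C}, [/\ coalgebra_hom p, cancel i p
    & forall s : seq E, exists2 rho, P rho & forall x, x \in s -> p x = rho x].
Proof.
move=> h0.
(* The default [rho0] makes the step total, so that [choice] yields a function to iterate. *)
have step (nr : nat * {linear E -> C}) : exists rho', hom_upto nr.1 nr.2 ->
    hom_upto nr.1.+1 rho' /\ forall e, F nr.1 e -> rho' e = nr.2 e.
  have [h|nh] := pselect (hom_upto nr.1 nr.2); last by exists rho0.
  by have [rho' h' e'] := hom_upto_step h; exists rho'.
have [S SP] := choice step.
pose r := fix r n := if n is n'.+1 then S (n', r n') else rho0.
have rh n : hom_upto n (r n) by elim: n => //= n IH; case: (SP (n, r n) IH).
have rS n e : F n e -> r n.+1 e = r n e by case: (SP (n, r n) (rh n)) => _; apply.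
have rle m n e : (m <= n)%N -> F m e -> r n e = r m e.
  move=> /subnK <- Fe; elim: (n - m)%N => // k IH.
  by rewrite addSn rS//; apply: filtration_le Fe => //; rewrite leq_addl.
have [N NP] := choice exhaustive.
pose p e := r (N e) e.
have pE n e : F n e -> p e = r n e.
  by move=> Fe; case: (leqP n (N e)) => [|/ltnW] le; [rewrite /p (rle _ _ _ le)|rewrite (rle _ _ _ le)].
have p_seq (s : seq E) : exists2 n, forall x, x \in s -> F n x & forall x, x \in s -> p x = r n x.
  have [|n nF] := @filtration_span _ _ _ _ hom_i s; first by move=> x _; exact: exhaustive.
  by exists n => x /span_seq_mem/nF // /pE.
have p_linear : linear p.
  move=> a x y; have [n _ nE] := p_seq [:: a *: x + y; x; y].
  by rewrite !nE ?linearP// !inE eqxx ?orbT.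
exists (linear_of p_linear); split=> [|c|s] /=.
- split=> e /=; last by case: (rh (N e)) => _ ->.
  (* One index [n] serves [e] and all legs of a decomposition of [coprod e]: there [p] is [r n],
     whose curvature vanishes at [e]. *)
  have [n nF nE] := p_seq (e :: [seq x.1 | x <- tdec (coprod e)] ++
                                [seq x.2 | x <- tdec (coprod e)]).
  have [_ _ _ /(_ e) cur] := rh n.
  rewrite nE ?mem_head//; have /eqP : curv (r n) e = 0 by apply/cur/nF/mem_head.
  rewrite subr_eq0 => /eqP ->; rewrite (tmapE_tsum (linear_of p_linear) (linear_of p_linear)).
  rewrite tmapE_tsum; apply: eq_big_seq => x xe /=.
  have x1 : x.1 \in e :: [seq x.1 | x <- tdec (coprod e)] ++ [seq x.2 | x <- tdec (coprod e)].
    by rewrite inE mem_cat (map_f (fun x => x.1) xe) orbT.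
  have x2 : x.2 \in e :: [seq x.1 | x <- tdec (coprod e)] ++ [seq x.2 | x <- tdec (coprod e)].
    by rewrite inE mem_cat (map_f (fun x => x.2) xe) !orbT.
  by rewrite !nE.
- by rewrite (pE 0%N _ (filtration_i 0 c)); case: h0 => _ _ rK _; exact: rK.
- by have [n _ nE] := p_seq s; exists (r n) => //; case: (rh n).
Qed.
End Lifting.

(** * The Casimir element of an integral *)

Section Casimir.
Variables (K : fieldType) (H : hopfAlgType K).
Local Notation S := (@antipode K H).

Lemma tsum_coprod_antipode (U : lmodType K) (h : H) (F : H -> H -> U) : bilin F ->
  tsum (coprod (S h)) F = tsum (coprod h) (fun a b => F (S b) (S a)).
Proof.
(* Both sides are convolution inverses of [coprod]; [G] is the product of the first,
   [coprod] and the second. *)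
move=> Fb; have [F1 F2] := Fb.
pose G p q h2 h3 := tsum (coprod h2) (fun u v => tsum (coprod h3) (fun c d =>
  F (p * u * S d) (q * v * S c))).
transitivity (tsum (coprod h) (fun h1 y => tsum (coprod y) (fun h2 h3 =>
  tsum (coprod (S h1)) (fun p q => G p q h2 h3)))).
  rewrite -(coprod_counitr h (f := fun x => tsum (coprod (S x)) F)); last by lin.
  apply: eq_tsum => h1 y; rewrite exchange_tsum.
  rewrite (lin_tsum _ _ (f := fun t => counit y *: t)); last by lin.
  apply: eq_tsum => p q; rewrite /G.
  rewrite coprod_assoc; last by trilin.
  transitivity (tsum (coprod y) (fun u w => F (p * u * S w) q)); last first.
    apply: eq_tsum => u w; rewrite -coprod_assoc; last by trilin.
    rewrite -(coprod_counitl w (f := fun d => F (p * u * S d) q)); last by lin.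
    apply: eq_tsum => x d.
    rewrite -[q in LHS]mulr1 -(tsum_antipoder x (f := fun z => F (p * u * S d) (q * z))); last by lin.
    by apply: eq_tsum => v c; rewrite mulrA.
  rewrite -[p in LHS]mulr1 -(tsum_antipoder y (f := fun z => F (p * z) q)); last by lin.
  by apply: eq_tsum => u w; rewrite mulrA.
rewrite -coprod_assoc; last by rewrite /G; trilin.
rewrite -(coprod_counitl h (f := fun x => tsum (coprod x) (fun a b => F (S b) (S a)))); last by lin.
apply: eq_tsum => x h3.
pose f z := tsum (coprod z) (fun p q => tsum (coprod h3) (fun c d => F (p * S d) (q * S c))).
transitivity (counit x *: f 1).
  rewrite -tsum_antipodel; last by rewrite /f; lin.
  by apply: eq_tsum => h1 h2; rewrite /f tsum_coprodM//; lin.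
rewrite /f tsum_coprod1; last by lin.
by congr (_ *: _); apply: eq_tsum => c d; rewrite !mul1r.
Qed.

Variable t : H.
Hypothesis int_t : ad_coinvariant_integral t.

(** The separability element of the algebra [H] attached to the integral: [casimir_mul] and
    [casimirC] are its two defining properties. *)
Definition casimir : H \ox H := tmap idfun S (coprod t).

Lemma tsum_casimir (U : lmodType K) (F : H -> H -> U) : bilin F ->
  tsum casimir F = tsum (coprod t) (fun a b => F a (S b)).
Proof. by move=> Fb; rewrite tsum_tmap. Qed.

Lemma casimir_mul (U : lmodType K) (f : H -> U) : lin f ->
  tsum casimir (fun u v => f (u * v)) = f 1.
Proof.
move=> fL; rewrite tsum_casimir; last by lin.
by rewrite tsum_antipoder//; case: int_t => _ _ ->; rewrite scale1r.
Qed.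

Lemma casimir_counit : \sum_(p <- tdec casimir) counit p.1 * counit p.2 = 1.
Proof.
have := casimir_mul (@lin_id _ H) => /(congr1 counit).
rewrite slin_tsum counit1 => <-; apply: eq_bigr => p _.
by rewrite counitM.
Qed.

Lemma casimirC (U : lmodType K) h (F : H -> H -> U) : bilin F ->
  tsum casimir (fun u v => F (h * u) v) = tsum casimir (fun u v => F u (v * h)).
Proof.
(* The two sides agree after applying the Galois map, which is injective. *)
move=> Fb.
pose gal (y : H \ox H) := tsum y (fun a b => tsum (coprod a) (fun a1 a2 => a1 \ot (a2 * b))).
pose gal' (y : H \ox H) := tsum y (fun a b => tsum (coprod a) (fun a1 a2 => a1 \ot (S a2 * b))).
have galL : lin gal by rewrite /gal; lin.
have gal'L : lin gal' by rewrite /gal'; lin.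
have gal_pure a b : gal (a \ot b) = tsum (coprod a) (fun a1 a2 => a1 \ot (a2 * b)).
  by rewrite /gal tsum_pure//; lin.
have galK y : gal' (gal y) = y.
  rewrite -[y in RHS]tsum_tpure {1}/gal (lin_tsum _ _ gal'L); apply: eq_tsum => a b.
  rewrite (lin_tsum _ _ gal'L).
  transitivity (tsum (coprod a) (fun x a3 => tsum (coprod x) (fun a1 a2 =>
     a1 \ot (S a2 * (a3 * b))))).
    by apply: eq_tsum => x a3; rewrite /gal' tsum_pure//; lin.
  rewrite coprod_assoc; last by trilin.
  rewrite -(coprod_counitr a (f := fun x => x \ot b)); last by lin.
  apply: eq_tsum => a1 w.
  rewrite -[b in RHS]mul1r -(tsum_antipodel w (f := fun z => a1 \ot (z * b))); last by lin.
  by apply: eq_tsum => u v; rewrite mulrA.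
suff E : tsum casimir (fun u v => (h * u) \ot v) = tsum casimir (fun u v => u \ot (v * h)).
  have /= := congr1 (fun y => tsum y F) E.
  have L : lin (fun y => tsum y F) by apply: lin_tsuml => //; exact: lin_id.
  rewrite !(lin_tsum _ _ L) => E'.
  transitivity (tsum casimir (fun u v => tsum ((h * u) \ot v) F)).
    by apply: eq_tsum => u v; rewrite tsum_pure.
  by rewrite E'; apply: eq_tsum => u v; rewrite tsum_pure.
rewrite -[LHS]galK -[RHS]galK; congr gal'.
(* The Galois map straightens t_1 \ot S(t_2) x into t \ot x, because t_2 S(t_3) cancels; [casimirC]
   thus reduces to h t = counit(h) t. *)
have key x : tsum (coprod t) (fun a b => tsum (coprod a) (fun a1 a2 => a1 \ot (a2 * S b * x))) = t \ot x.
  rewrite coprod_assoc; last by trilin.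
  rewrite -(coprod_counitr t (f := fun y => y \ot x)); last by lin.
  apply: eq_tsum => a w.
  by rewrite (tsum_antipoder w (f := fun z => a \ot (z * x))) ?mul1r//; lin.
transitivity (t \ot h); last first.
  rewrite (lin_tsum _ _ galL) tsum_casimir; last by lin.
  rewrite -key; apply: eq_tsum => a b; rewrite gal_pure.
  by apply: eq_tsum => a1 a2; rewrite mulrA.
rewrite (lin_tsum _ _ galL) tsum_casimir; last by lin.
transitivity (tsum (coprod h) (fun h1 h2 => tsum (coprod t) (fun a b =>
   tsum (coprod a) (fun a1 a2 => (h1 * a1) \ot (h2 * (a2 * S b)))))).
  rewrite exchange_tsum; apply: eq_tsum => a b; rewrite gal_pure tsum_coprodM; last by lin.
  by apply: eq_tsum => h1 h2; apply: eq_tsum => a1 a2; rewrite mulrA.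
rewrite -(coprod_counitl h (f := fun x => t \ot x)); last by lin.
apply: eq_tsum => h1 h2; rewrite coprod_assoc; last by trilin.
transitivity ((h1 * t) \ot h2); last by case: int_t => -> _ _; rewrite linearZl_LR.
rewrite -(coprod_counitr t (f := fun y => (h1 * y) \ot h2)); last by lin.
apply: eq_tsum => a w.
by rewrite (tsum_antipoder w (f := fun z => (h1 * a) \ot (h2 * z))) ?mulr1//; lin.
Qed.

(** As the antipode reverses coproducts, the legs multiplied are t_2 and S(t_3), which are adjacent
    and cancel. *)
Lemma casimir_coprodr (U : lmodType K) (F : H -> H -> H -> U) : trilin F ->
  tsum casimir (fun u v => tsum (coprod u) (fun u1 u2 =>
    tsum (coprod v) (fun v1 v2 => F u1 v1 (u2 * v2)))) =
  tsum casimir (fun u v => F u v 1).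
Proof.
move=> [F1 F2 F3]; rewrite !tsum_casimir; try by lin.
transitivity (tsum (coprod t) (fun a b => tsum (coprod a) (fun a1 a2 =>
   tsum (coprod b) (fun b1 b2 => F a1 (S b2) (a2 * S b1))))).
  apply: eq_tsum => a b; apply: eq_tsum => a1 a2.
  by rewrite tsum_coprod_antipode//; lin.
rewrite coprod_assoc; last by trilin.
apply: eq_tsum => a1 w; rewrite -coprod_assoc; last by trilin.
rewrite -(coprod_counitl w (f := fun z => F a1 (S z) 1)); last by lin.
apply: eq_tsum => y b2.
by rewrite (tsum_antipoder y (f := fun z => F a1 (S b2) z)) //; lin.
Qed.

(** Here the legs multiplied are t_1 and S(t_4), with t_2 and t_3 in between: ad-coinvariance,
    followed by a coproduct of its second leg, is what cancels them. *)
Lemma casimir_coprodl (U : lmodType K) (F : H -> H -> H -> U) : trilin F ->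
  tsum casimir (fun u v => tsum (coprod u) (fun u1 u2 =>
    tsum (coprod v) (fun v1 v2 => F (u1 * v1) u2 v2))) =
  tsum casimir (fun u v => F 1 u v).
Proof.
move=> [F1 F2 F3]; rewrite !tsum_casimir; try by lin.
transitivity (tsum (coprod t) (fun a b => tsum (coprod a) (fun a1 a2 =>
   tsum (coprod b) (fun b1 b2 => F (a1 * S b2) a2 (S b1))))).
  apply: eq_tsum => a b; apply: eq_tsum => a1 a2.
  by rewrite tsum_coprod_antipode//; lin.
rewrite coprod_assoc; last by trilin.
pose Phi z := tsum z (fun x y => tsum (coprod y) (fun y1 y2 => F x y1 (S y2))).
have PhiL : lin Phi by rewrite /Phi; lin.
have Phi_pure x y : Phi (x \ot y) = tsum (coprod y) (fun y1 y2 => F x y1 (S y2)).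
  by rewrite /Phi tsum_pure//; lin.
have ad : tsum (coprod t) (fun t1 w => tsum (coprod w) (fun t2 t3 => (t1 * S t3) \ot t2)) = 1 \ot t.
  case: int_t => _ <- _.
  have E (t1 : H) (t23 : H \ox H) : tlift (fun t2 t3 => (t1 * S t3) \ot t2) t23
                = tsum t23 (fun t2 t3 => (t1 * S t3) \ot t2) by rewrite tsumE//; lin.
  rewrite (eq_tlift E) -tsumE; last by lin.
  by rewrite tsum_tmap//; lin.
rewrite -Phi_pure -ad (lin_tsum _ _ PhiL); apply: eq_tsum => a1 w.
rewrite (lin_tsum _ _ PhiL) -coprod_assoc; last by trilin.
by apply: eq_tsum => y b2; rewrite Phi_pure.
Qed.
End Casimir.

(** * Averaging *)

(* One-sided actions of H on E and on H: [op] is the product of H or its opposite, and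
   [cas] lists the two legs of the Casimir element, the first one acting on E. *)
Record averaging_action (K : fieldType) (H : hopfAlgType K) (E : coalgType K)
    (i : {linear H -> E}) := AveragingAction {
  act : H -> E -> E;
  actH : H -> H -> H;
  op : H -> H -> H;
  cas : seq (H * H);
  act_bilin : bilin act;
  actH_bilin : bilin actH;
  op_bilin : bilin op;
  act_op : forall h k e, act (op h k) e = act h (act k e);
  actH_op : forall h k x, actH (op h k) x = actH h (actH k x);
  actH1 : forall x, actH 1 x = x;
  tsum_act : forall (U : lmodType K) h e (F : E -> E -> U), bilin F ->
    tsum (coprod (act h e)) F = tsum (coprod h) (fun h1 h2 =>
      tsum (coprod e) (fun e1 e2 => F (act h1 e1) (act h2 e2)));
  tsum_actH : forall (U : lmodType K) h x (F : H -> H -> U), bilin F ->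
    tsum (coprod (actH h x)) F = tsum (coprod h) (fun h1 h2 =>
      tsum (coprod x) (fun x1 x2 => F (actH h1 x1) (actH h2 x2)));
  counit_act : forall h e, counit (act h e) = counit h * counit e;
  counit_actH : forall h x, counit (actH h x) = counit h * counit x;
  act_i : forall h x, i (actH h x) = act h (i x);
  cas_comm : forall (U : lmodType K) h (F : H -> H -> U), bilin F ->
    \sum_(p <- cas) F (op p.1 h) p.2 = \sum_(p <- cas) F p.1 (op h p.2);
  cas_mul : forall (U : lmodType K) (f : H -> U), lin f ->
    \sum_(p <- cas) f (op p.2 p.1) = f 1;
  cas_coprodl : forall (U : lmodType K) (F : H -> H -> H -> U), trilin F ->
    \sum_(p <- cas) tsum (coprod p.1) (fun c1 c2 => tsum (coprod p.2) (fun d1 d2 =>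
      F (op d1 c1) c2 d2)) = \sum_(p <- cas) F 1 p.1 p.2;
  cas_coprodr : forall (U : lmodType K) (F : H -> H -> H -> U), trilin F ->
    \sum_(p <- cas) tsum (coprod p.1) (fun c1 c2 => tsum (coprod p.2) (fun d1 d2 =>
      F c1 d1 (op d2 c2))) = \sum_(p <- cas) F p.1 p.2 1;
  cas_counit : \sum_(p <- cas) counit p.1 * counit p.2 = 1
}.

Section Averaging.
Variables (K : fieldType) (H : hopfAlgType K) (E : coalgType K) (i : {linear H -> E}).
Hypothesis hom_i : coalgebra_hom i.
Variable A : averaging_action i.
Local Notation act := (act A).
Local Notation actH := (actH A).
Local Notation op := (op A).
Local Notation cas := (cas A).
Implicit Types r g rho : {linear E -> H}.

Definition equivariant (r : E -> H) : Prop := forall h e, r (act h e) = actH h (r e).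

Lemma act_linr h : lin (act h). Proof. by case: (act_bilin A). Qed.
Lemma act_linl e : lin (act^~ e). Proof. by case: (act_bilin A). Qed.
Lemma actH_linr h : lin (actH h). Proof. by case: (actH_bilin A). Qed.
Lemma actH_linl x : lin (actH^~ x). Proof. by case: (actH_bilin A). Qed.
Lemma op_linr h : lin (op h). Proof. by case: (op_bilin A). Qed.
Lemma op_linl k : lin (op^~ k). Proof. by case: (op_bilin A). Qed.
Hint Resolve act_linr act_linl actH_linr actH_linl op_linr op_linl : core.

(** If [f] vanishes on the image of [i], so does [f] composed with the action of any element,
    because [i] is equivariant. *)
Lemma filtration_act n h e : filtration i n e -> filtration i n (act h e).
Proof.
elim: n h e => [h _ [x ->]|n IH h e Fe f fi0]; first by exists (actH h x); rewrite act_i.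
rewrite hitlE tsum_act; last by lin.
apply: (subspace_sum _ (filtration_subspace _ _)) => -[h1 h2] /=.
have -> : tsum (coprod e) (fun e1 e2 => f (act h2 e2) *: act h1 e1) =
    act h1 (hitl (f \o linear_of (act_linr h2)) e).
  rewrite hitlE (lin_tsum _ _ (act_linr h1)); apply: eq_tsum => e1 e2 /=.
  by rewrite -[RHS]/(linear_of (act_linr h1) _) linearZ.
by apply/IH/Fe => c /=; rewrite -act_i.
Qed.

Definition avg (r : E -> H) (e : E) : H := \sum_(p <- cas) actH p.2 (r (act p.1 e)).

Lemma avg_lin (r : {linear E -> H}) : linear (avg r).
Proof.
move=> a x y; rewrite /avg scaler_sumr -big_split/=; apply: eq_bigr => p _.
by rewrite act_linr linearP actH_linr.
Qed.

Lemma avg_equivariant r : equivariant (avg r).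
Proof.
move=> h e; rewrite /avg.
transitivity (\sum_(p <- cas) actH p.2 (r (act (op p.1 h) e))).
  by apply: eq_bigr => p _; rewrite act_op.
rewrite (cas_comm A h (F := fun c d => actH d (r (act c e)))); last by lin.
rewrite -[RHS]/(linear_of (actH_linr h) _) linear_sum; apply: eq_bigr => p _ /=.
by rewrite actH_op.
Qed.

Lemma avg_section r : cancel i r -> cancel i (avg r).
Proof.
move=> ir x; rewrite -[RHS](actH1 A) -(cas_mul A (actH_linl x)); apply: eq_bigr => p _.
by rewrite -act_i ir actH_op.
Qed.

Lemma avg_counit r e : (forall e, counit (r e) = counit e) -> counit (avg r e) = counit e.
Proof.
move=> cr; rewrite linear_sum -[RHS]mul1r -(cas_counit A) mulr_suml.
by apply: eq_bigr => p _; rewrite /= counit_actH cr counit_act mulrCA mulrA.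
Qed.

(** The averaged map solves the same equation because [rho] is equivariant: the action leaves [rho]
    and [curv rho], and the products so formed are those that the coproduct identities of the
    Casimir element collapse. *)
Lemma avg_corrects n rho g : equivariant rho -> corrects i n rho g ->
  corrects i n rho (linear_of (avg_lin g)).
Proof.
move=> eqr [cg Fg Hg]; split=> [e|e Fe|e Fe] /=.
- by rewrite linear_sum big1// => p _; rewrite /= counit_actH cg mulr0.
- rewrite /avg big1// => p _; rewrite Fg; first by exact: (linear0 (linear_of (actH_linr p.2))).
  exact: filtration_act.
transitivity (\sum_(p <- cas) tsum (coprod p.1) (fun c1 c2 => tsum (coprod p.2) (fun d1 d2 =>
    tsum (coprod e) (fun e1 e2 => actH (op d1 c1) (rho e1) \ot actH d2 (g (act c2 e2)))))
  + \sum_(p <- cas) tsum (coprod p.1) (fun c1 c2 => tsum (coprod p.2) (fun d1 d2 =>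
    tsum (coprod e) (fun e1 e2 => actH d1 (g (act c1 e1)) \ot actH (op d2 c2) (rho e2))))
  - \sum_(p <- cas) tsum (coprod p.1) (fun c1 c2 => tsum (coprod p.2) (fun d1 d2 =>
    tsum (curv rho e) (fun x y => actH (op d1 c1) x \ot actH (op d2 c2) y)))).
  rewrite /avg linear_sum -big_split -sumrB/=; apply: eq_bigr => p _.
  rewrite -[LHS]tsum_tpure tsum_actH; last by lin.
  (* The equation for [g] at the point [act p.1 e], available since the action preserves F_(n+1). *)
  have e'E : forall (U : lmodType K) (G : H -> H -> U), bilin G ->
      tsum (coprod (g (act p.1 e))) G =
      tsum (coprod p.1) (fun c1 c2 => tsum (coprod e) (fun e1 e2 =>
        G (actH c1 (rho e1)) (g (act c2 e2)))) +
      tsum (coprod p.1) (fun c1 c2 => tsum (coprod e) (fun e1 e2 =>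
        G (g (act c1 e1)) (actH c2 (rho e2)))) -
      tsum (coprod p.1) (fun c1 c2 => tsum (curv rho e) (fun x y =>
        G (actH c1 x) (actH c2 y))).
    move=> U G Gb; have [G1 G2] := Gb.
    have L : lin (fun z => tsum z G) by apply: lin_tsuml => //; exact: lin_id.
    rewrite Hg; last exact: filtration_act.
    rewrite -[LHS]/(linear_of L _) linearB linearD/= !tsum_tmap// !tsum_act; try by lin.
    congr (_ + _ - _).
    - by apply: eq_tsum => c1 c2; apply: eq_tsum => e1 e2; rewrite eqr.
    - by apply: eq_tsum => c1 c2; apply: eq_tsum => e1 e2; rewrite eqr.
    rewrite tsum_curv// eqr tsum_actH// tsum_act; last by lin.
    rewrite -tsumB; apply: eq_tsum => c1 c2; rewrite tsum_curv; last by lin.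
    by congr (_ - _); apply: eq_tsum => e1 e2; rewrite !eqr.
  rewrite [X in _ = X + _ - _]exchange_tsum [X in _ = _ + X - _]exchange_tsum.
  rewrite [X in _ = _ - X]exchange_tsum -tsumD -tsumB; apply: eq_tsum => d1 d2.
  rewrite e'E; last by lin.
  congr (_ + _ - _); apply: eq_tsum => c1 c2; apply: eq_tsum => x y; by rewrite ?actH_op.
congr (_ + _ - _).
- rewrite (cas_coprodl A (F := fun a c d => tsum (coprod e) (fun e1 e2 =>
    actH a (rho e1) \ot actH d (g (act c e2))))); last by trilin.
  rewrite (tmapE_tsum rho (linear_of (avg_lin g))) exchange_big; apply: eq_bigr => q _ /=.
  by rewrite /avg linear_sum; apply: eq_bigr => p _; rewrite actH1.
- rewrite (cas_coprodr A (F := fun c d a => tsum (coprod e) (fun e1 e2 =>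
    actH d (g (act c e1)) \ot actH a (rho e2)))); last by trilin.
  rewrite (tmapE_tsum (linear_of (avg_lin g)) rho) exchange_big; apply: eq_bigr => q _ /=.
  rewrite /avg -[RHS]/(applyr tpure (rho q.2) _) linear_sum; apply: eq_bigr => p _.
  by rewrite actH1.
(* The curvature carries a product of Casimir legs on both sides: the first collapses by
   [cas_coprodl], then the second by [cas_mul]. *)
rewrite (cas_coprodl A (F := fun a c d => tsum (curv rho e) (fun x y =>
  actH a x \ot actH (op d c) y))); last by trilin.
rewrite (cas_mul A (f := fun b => tsum (curv rho e) (fun x y => actH 1 x \ot actH b y))); last by lin.
by rewrite -[RHS]tsum_tpure; apply: eq_tsum => x y; rewrite !actH1.
Qed.
End Averaging.

(** * Lifting *)

Lemma linear_retraction (K : fieldType) (V W : lmodType K) (f : {linear V -> W}) :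
  injective f -> exists r : {linear W -> V}, cancel f r.
Proof.
move=> f_inj; pose R w := exists v, w = f v.
have sR : subspace R.
  split=> [|a _ _ [v ->] [w ->]]; first by exists 0; rewrite linear0.
  by exists (a *: v + w); rewrite linearP.
have s0 : subspace (fun x : W => x = 0).
  by split=> // a x y -> ->; rewrite scaler0 addr0.
have [p [pR pid _]] := exists_projection sR s0 (fun x _ => id).
have [r rP] := choice pR.
have r_linear : linear r by move=> a x y; apply: f_inj; rewrite -rP linearP !rP linearP.
by exists (linear_of r_linear) => v /=; apply: f_inj; rewrite -rP pid//; exists v.
Qed.

(** A multiple of 1 repairs the counit; the multiple vanishes on the image of [i], so the retraction
    survives. *)
Lemma counital_retraction (K : fieldType) (H : bialgType K) (E : coalgType K)
    (i : {linear H -> E}) : coalgebra_hom i -> injective i ->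
  exists r : {linear E -> H}, cancel i r /\ forall e, counit (r e) = counit e.
Proof.
move=> [_ ci] /linear_retraction[r rK].
have r'_linear : linear (fun e => r e + (counit e - counit (r e)) *: (1 : H)).
  move=> a x y; rewrite !linearP/= ?linearP/= scalerDr scalerA.
  rewrite [RHS]addrACA -scalerDl mulrBr; congr (_ + _ *: _).
  by rewrite opprD addrACA.
exists (linear_of r'_linear); split=> [h|e] /=.
  by rewrite rK ci subrr scale0r addr0.
by rewrite linearD linearZ/= counit1 mulr1 addrC subrK.
Qed.

Section EquivariantLift.
Variables (K : fieldType) (H : hopfAlgType K) (E : coalgType K) (i : {linear H -> E}).
Hypothesis smooth : formally_smooth H.
Hypothesis hom_i : coalgebra_hom i.
Hypothesis i_inj : injective i.
Hypothesis corad_sub : forall e, e \in corad E -> exists h, i h = e.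

Lemma curv_section (rho : {linear E -> H}) h : cancel i rho -> curv rho (i h) = 0.
Proof.
move=> rK; rewrite /curv rK; case: hom_i => -> _; rewrite tmap_comp.
by rewrite (@eq_tmap _ _ _ _ _ _ idfun _ idfun) ?tmap_id ?subrr// => x; rewrite /= rK.
Qed.

Lemma equivariant_lift (A : averaging_action i) :
  exists p : {linear E -> H}, [/\ coalgebra_hom p, cancel i p & equivariant A p].
Proof.
have [D [D1 D2]] := formally_smooth_coderivation smooth.
have [r [rK cr]] := counital_retraction hom_i i_inj.
have [|||p [hom_p pK pP]] := @hom_lift _ _ _ i hom_i D D1 D2
  (filtration_exhaustive hom_i corad_sub) (fun r => equivariant A r) _ _
  (linear_of (avg_lin A r)).
- move=> f g ef eg h e /=; rewrite ef eg.
  by rewrite -[RHS]/(linear_of (actH_linr A h) _) linearD.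
- move=> n rho g erho gP; exists (linear_of (avg_lin A g)); first exact: avg_equivariant.
  exact: avg_corrects.
- have aK : cancel i (linear_of (avg_lin A r)) by exact: avg_section.
  split=> //; [exact: avg_equivariant|by move=> e; exact: avg_counit|].
  by move=> _ [h ->]; exact: curv_section.
exists p; split=> // h e; have [rho erho pE] := pP [:: act A h e; e].
by rewrite !pE ?erho// !inE eqxx ?orbT.
Qed.

Lemma avg_equivariant2 (A B : averaging_action i) (r : {linear E -> H}) :
  (forall h k e, act A h (act B k e) = act B k (act A h e)) ->
  (forall h k x, actH A h (actH B k x) = actH B k (actH A h x)) ->
  equivariant A r -> equivariant A (avg B r).
Proof.
move=> AB ABH eA h e; rewrite /avg -[RHS]/(linear_of (actH_linr A h) _) linear_sum.
by apply: eq_bigr => p _ /=; rewrite -AB eA ABH.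
Qed.

Lemma biequivariant_lift (A B : averaging_action i) :
  (forall h k e, act A h (act B k e) = act B k (act A h e)) ->
  (forall h k x, actH A h (actH B k x) = actH B k (actH A h x)) ->
  exists p : {linear E -> H},
    [/\ coalgebra_hom p, cancel i p, equivariant A p & equivariant B p].
Proof.
move=> AB ABH.
have [D [D1 D2]] := formally_smooth_coderivation smooth.
have [r [rK cr]] := counital_retraction hom_i i_inj.
(* The [A]-equivariance obtained first survives the averaging over [B] because the two actions
   commute. *)
pose av r := linear_of (avg_lin B (linear_of (avg_lin A r))).
have av_eq r' : equivariant A (av r') /\ equivariant B (av r').
  by split; [apply: avg_equivariant2 => //; exact: avg_equivariant|exact: avg_equivariant].
have [|||p [hom_p pK pP]] := @hom_lift _ _ _ i hom_i D D1 D2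
  (filtration_exhaustive hom_i corad_sub)
  (fun r => equivariant A r /\ equivariant B r) _ _ (av r).
- move=> f g [fA fB] [gA gB]; split=> h e /=; rewrite ?fA ?gA ?fB ?gB.
    by rewrite -[RHS]/(linear_of (actH_linr A h) _) linearD.
  by rewrite -[RHS]/(linear_of (actH_linr B h) _) linearD.
- move=> n rho g [rA rB] gP; exists (av g) => //.
  by apply: avg_corrects => //; exact: avg_corrects.
- have aK : cancel i (av r) by do 2!apply: avg_section.
  split=> //; first by move=> e; do 2!apply: avg_counit => // ?.
  by move=> _ [h ->]; exact: curv_section.
exists p; split=> // h e.
  have [rho [rA _] pE] := pP [:: act A h e; e].
  by rewrite !pE ?rA// !inE eqxx ?orbT.
have [rho [_ rB] pE] := pP [:: act B h e; e].
by rewrite !pE ?rB// !inE eqxx ?orbT.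
Qed.
End EquivariantLift.

(** * The right and left actions of [H] *)

Section Actions.
Variables (K : fieldType) (H : hopfAlgType K) (t : H).
Hypothesis int_t : ad_coinvariant_integral t.

Lemma ract_bilin (E : rmodule_coalgebra H) : bilin (fun h (e : E) => ract e h).
Proof. by case: (@ract_bilinear _ _ E) => l r; split=> x; [exact: r|exact: l]. Qed.

Lemma lact_bilin (E : bimodule_coalgebra H) : bilin (@lact _ _ E).
Proof. by case: (@lact_bilinear _ _ E) => l r; split=> x; [exact: l|exact: r]. Qed.

(** The opposite product turns the right action into a left one; the average of [r] is e |-> r(e
    t_1) S(t_2). *)
Definition right_action (E : rmodule_coalgebra H)
    (i : {linear regular_rmodule_coalgebra H -> E}) (hi : rmodule_coalgebra_hom i) :
  averaging_action (i : {linear H -> E}).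
Proof.
refine (@AveragingAction K H E i (fun h e => ract e h) (fun h x => x * h)
  (fun h k => k * h) (tdec (casimir t)) (ract_bilin E) _ _ _ _ _ _ _ _ _ _ _ _ _ _ _).
- by lin.
- by lin.
- by move=> h k e; rewrite ractM.
- by move=> h k x; rewrite mulrA.
- exact: mulr1.
- move=> U h e F Fb; have [l r] := ract_bilin E.
  have rb : bilin (@ract _ _ E) by split=> x; [exact: r|exact: l].
  by rewrite coprod_ract (tsum_tmap2 _ _ rb rb Fb) exchange_tsum.
- by move=> U h x F Fb; rewrite (tsum_coprodM _ _ Fb) exchange_tsum.
- by move=> h e; rewrite counit_ract mulrC.
- by move=> h e; rewrite counitM mulrC.
- by move=> h x; case: hi => _ ->.
- by move=> U h F Fb; apply: (casimirC int_t h Fb).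
- by move=> U f fL; exact: (casimir_mul int_t fL).
- by move=> U F Ft; exact: (casimir_coprodl int_t Ft).
- by move=> U F Ft; exact: (casimir_coprodr t Ft).
- exact: casimir_counit.
Defined.

(** The legs of the Casimir element are swapped, so that the average of [r] is e |-> t_1 r(S(t_2)
    e). *)
Definition left_action (E : bimodule_coalgebra H)
    (i : {linear regular_bimodule_coalgebra H -> E}) (hi : bimodule_coalgebra_hom i) :
  averaging_action (i : {linear H -> E}).
Proof.
refine (@AveragingAction K H E i (fun h e => lact h e) (fun h x => h * x)
  (fun h k => h * k) [seq (p.2, p.1) | p <- tdec (casimir t)] (lact_bilin E) _ _ _ _ _ _ _ _ _ _ _ _ _ _ _).
- by lin.
- by lin.
- by move=> h k e; rewrite lactM.
- by move=> h k x; rewrite mulrA.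
- exact: mul1r.
- by move=> U h e F Fb; rewrite coprod_lact (tsum_tmap2 _ _ (lact_bilin E) (lact_bilin E) Fb).
- by move=> U h x F Fb; rewrite (tsum_coprodM _ _ Fb).
- by move=> h e; rewrite counit_lact.
- by move=> h e; rewrite counitM.
- by move=> h x; case: hi => _ ->.
- move=> U h F Fb; rewrite !big_map; have [F1 F2] := Fb.
  by apply/esym/(casimirC int_t h (F := fun u v => F v u)); split; lin.
- by move=> U f fL; rewrite big_map; exact: (casimir_mul int_t fL).
- move=> U F [F1 F2 F3]; rewrite !big_map.
  rewrite -[RHS](casimir_coprodl int_t (F := fun x u v => F x v u)); last by trilin.
  by apply: eq_bigr => p _; rewrite exchange_tsum.
- move=> U F [F1 F2 F3]; rewrite !big_map.
  rewrite -[RHS](casimir_coprodr t (F := fun u v x => F v u x)); last by trilin.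
  by apply: eq_bigr => p _; rewrite exchange_tsum.
- rewrite big_map -[RHS](casimir_counit int_t); apply: eq_bigr => p _.
  by rewrite mulrC.
Defined.
End Actions.

Theorem theorem8p11 (K : fieldType) (H : hopfAlgType K)
  (hint : exists t : H, ad_coinvariant_integral t)
  (hsmooth : formally_smooth H) :
  (forall (E : rmodule_coalgebra H)
          (i : {linear regular_rmodule_coalgebra H -> E}),
     rmodule_coalgebra_hom i -> injective i ->
     (forall e : E, e \in corad E -> exists h, i h = e) ->
     exists2 p : {linear E -> regular_rmodule_coalgebra H},
       rmodule_coalgebra_hom p & cancel i p)
  /\
  (forall (E : bimodule_coalgebra H)
          (i : {linear regular_bimodule_coalgebra H -> E}),
     bimodule_coalgebra_hom i -> injective i ->
     (forall e : E, e \in corad E -> exists h, i h = e) ->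
     exists2 p : {linear E -> regular_bimodule_coalgebra H},
       bimodule_coalgebra_hom p & cancel i p).
Proof.
case: hint => t int_t; split=> E i hi i_inj corad_sub.
  have [p [hom_p pK pr]] := equivariant_lift hsmooth (proj1 hi) i_inj corad_sub
    (right_action int_t hi).
  by exists p => //; split=> // e h; exact: (pr h e).
have [p [hom_p pK pr pl]] := @biequivariant_lift K H E i hsmooth (proj1 (proj1 hi)) i_inj corad_sub
  (@right_action K H t int_t E i (proj1 hi)) (left_action int_t hi) 
  (fun h k e => lractA k e h) (fun h k x => esym (mulrA k x h)).
by exists p => //; split=> //; split=> // e h; exact: pr.
Qed.
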